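(* Let $\mathcal{C}(\mathcal{I})$ be a decreasing monomial code and $r=\max_{f\in \mathcal{I}}\deg(f)$. Then any codeword of weight $1.5\,\mathrm{w}_{\min}$, say $\operatorname{ev}(P)$, is such that there exist $f,g\in \mathcal{I}_r$ with $$P\in{\rm LTA}(m,2)_h\cdot h\cdot\Big({\rm LTA}(m,2)_{f} \cdot \tfrac{f}{h}+{\rm LTA}(m,2)_{g}\cdot \tfrac{g}{h}\Big),$$ where $h=\gcd(f,g)$ and $\deg(h)=r-2$.
   Context: Work in $\mathbf{R}_m=\mathbb{F}_2[x_0,\dots,x_{m-1}]/(x_i^2-x_i)$; $\operatorname{ev}(P)\in\mathbb{F}_2^{2^m}$ is the evaluation of $P$ at all points of $\mathbb{F}_2^m$, and $\mathrm{w}(\cdot)$ denotes Hamming weight. For a monomial set $\mathcal{I}$, $\mathcal{C}(\mathcal{I})=\operatorname{span}\{\operatorname{ev}(f): f\in\mathcal{I}\}$ and $\mathcal{I}_r=\{f\in\mathcal{I}:\deg f=r\}$. The partial order $\preceq$ on monomials: $f\preceq g$ iff there is $g^*$ with $f\preceq_{sh} g^*$ and $g^*\mid g$, where for $f=x_{i_1}\cdots x_{i_s}$, $g^*=x_{j_1}\cdots x_{j_s}$ (indices increasing), $f\preceq_{sh}g^*$ means $i_\ell\le j_\ell$ for all $\ell$. $\mathcal{I}$ is decreasing if $f\in\mathcal{I}$ and $g\preceq f$ imply $g\in\mathcal{I}$. The minimum weight of $\mathcal{C}(\mathcal{I})$ is $\mathrm{w}_{\min}=2^{m-r}$. ${\rm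 LTA}(m,2)$ is the group of affine maps $\mathbf{x}\mapsto \mathbf{B}\mathbf{x}+\boldsymbol{\varepsilon}$ with $\mathbf{B}$ lower triangular with unit diagonal, acting on monomials by replacing $x_i$ with $x_i+\sum_{j<i}b_{i,j}x_j+\varepsilon_i$. For a monomial $g$, ${\rm LTA}(m,2)_g$ is the subgroup with $\varepsilon_i=0$ for $i\notin\operatorname{ind}(g)$, and $b_{i,j}=0$ whenever $i\notin\operatorname{ind}(g)$ or $j\in\operatorname{ind}(g)$ ($\operatorname{ind}(g)$ = set of indices of variables of $g$). For a group $G$ and monomial $f$, $G\cdot f$ is the orbit; for polynomial sets, $\mathcal{S}+\mathcal{T}=\{s+t\}$ (Minkowski sum) and $\mathcal{S}\cdot\mathcal{T}=\{st\}$. *)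

(* Defs.v *)
From mathcomp Require Import all_boot all_order all_algebra.
Set Implicit Arguments. Unset Strict Implicit. Unset Printing Implicit Defensive.
Import GRing.Theory.
Local Open Scope ring_scope.

Notation pt m := {ffun 'I_m -> 'F_2}.

(* R_m = F_2[x_0..x_{m-1}]/(x_i^2 - x_i) is modelled (ring-isomorphically, via
   ev) by the functions F_2^m -> F_2; a polynomial is identified with ev(P). *)
Notation Rm m := {ffun pt m -> 'F_2}.

(* A monomial x_{i_1}...x_{i_s} is given by its index set ind(f). *)
Notation mono m := {set 'I_m}.

Definition mono_ev (m : nat) (f : mono m) : Rm m :=
  [ffun x : pt m => \prod_(i in f) x i].

Definition Rm_add (m : nat) (P Q : Rm m) : Rm m := [ffun x : pt m => P x + Q x].
Definition Rm_mul (m : nat) (P Q : Rm m) : Rm m := [ffun x : pt m => P x * Q x].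

Definition wt (m : nat) (P : Rm m) : nat := #|[set x : pt m | P x != 0]|.

Definition in_code (m : nat) (I : {set mono m}) (P : Rm m) : Prop :=
  exists c : mono m -> 'F_2, forall x, P x = \sum_(f in I) c f * mono_ev f x.

Definition sidx (m : nat) (f : mono m) : seq nat :=
  sort leq [seq val i | i <- enum f].

Definition sh_le (m : nat) (f g : mono m) : bool :=
  (#|f| == #|g|) &&
  [forall k : 'I_m, (k < #|f|)%N ==> (nth 0%N (sidx f) k <= nth 0%N (sidx g) k)%N].

Definition mono_le (m : nat) (f g : mono m) : bool :=
  [exists gs : mono m, (gs \subset g) && sh_le f gs].

Definition decreasing (m : nat) (I : {set mono m}) : Prop :=
  forall f g : mono m, f \in I -> mono_le g f -> g \in I.

Definition maxdeg (m : nat) (I : {set mono m}) : nat := \max_(f in I) #|f|.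

(* An element of LTA(m,2): x |-> Bx + eps, B lower triangular unit diagonal,
   given by its strictly-lower entries b i j (j < i) and eps. *)
Definition lta_app (m : nat) (b : 'I_m -> 'I_m -> 'F_2) (e : 'I_m -> 'F_2)
  (x : pt m) : pt m :=
  [ffun i : 'I_m => x i + \sum_(j < m | (j < i)%N) b i j * x j + e i].

Definition lta_act (m : nat) (b : 'I_m -> 'I_m -> 'F_2) (e : 'I_m -> 'F_2)
  (P : Rm m) : Rm m := [ffun x : pt m => P (lta_app b e x)].

Definition in_LTA_sub (m : nat) (g : mono m) (b : 'I_m -> 'I_m -> 'F_2)
  (e : 'I_m -> 'F_2) : Prop :=
  (forall i, i \notin g -> e i = 0) /\
  (forall i j : 'I_m, (j < i)%N -> (i \notin g) || (j \in g) -> b i j = 0).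

Definition lta_orbit (m : nat) (g f : mono m) (P : Rm m) : Prop :=
  exists b e, in_LTA_sub g b e /\ P = lta_act b e (mono_ev f).

(* Main.v *)
Require Import Defs.
From mathcomp Require Import all_boot all_order all_algebra.
From mathcomp Require Import zify.
Set Implicit Arguments.
Unset Strict Implicit.
Unset Printing Implicit Defensive.
Import GRing.Theory.
Local Open Scope ring_scope.

(* Put r = maxdeg I and d = 2^(m-r), and measure degree by iterated derivatives, so that it
   restricts to affine subspaces (flats).  A nonzero function of degree <= r has weight >= d, with
   equality only for indicators of flats, and no weight lies strictly between d and 3d/2.  Hence each
   hyperplane splits the support of P, of weight 3d/2, as (0, 3d/2), (d/2, d) or (3d/4, 3d/4).
   If r >= 3 some hyperplane misses the support, and restricting to its complement lowers r by one;
   if r = 2 the lighter half of a (d/2, d) split is a flat of codimension 2 in its hyperplane, which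
   gives P = y1 y2 + y3 y4 for affine forms y_i on a flat of codimension r - 2.
   Elimination with largest variables as pivots puts the equations of that flat in reduced form, with
   pivot set h; among the quadruples (y1, y2, y3, y4) representing P and free of the variables in h,
   one with the least sum of leading indices has four distinct leading indices s1, s2, s3, s4.
   So P is the image of f + g under some T in LTA(m,2), where f = h + {s1,s2} and g = h + {s3,s4};
   as C(I) is finite and LTA-invariant, f + g lies in C(I), whence f and g lie in I. *)


(** * Arithmetic of the two-element field *)

Lemma F2P (x : 'F_2) : x = 0 \/ x = 1.
Proof. by case: x => [[|[|[]]]] // i; [left|right]; apply/val_inj. Qed.

Lemma F2_neq0 (x : 'F_2) : (x != 0) = (x == 1).
Proof. by case: (F2P x) => ->. Qed.

Lemma F2_neq (x y : 'F_2) : (x != y) = (x == y + 1).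
Proof. by case: (F2P x) => ->; case: (F2P y) => ->. Qed.

Lemma F2_mulxx (x : 'F_2) : x * x = x.
Proof. by case: (F2P x) => ->; apply/eqP. Qed.

Lemma F2_addxx (x : 'F_2) : x + x = 0.
Proof. by case: (F2P x) => ->; apply/eqP. Qed.

(** * Flats of F_2^m *)

Section Points.
Variable m : nat.
Implicit Types (x y z v : pt m) (A B : {set pt m}).

Lemma pt_addxx x : x + x = 0.
Proof. by apply/ffunP=> i; rewrite !ffunE F2_addxx. Qed.

Lemma pt_addK x y : x + y + y = x.
Proof. by rewrite -addrA pt_addxx addr0. Qed.

Lemma pt_addKl x y : x + (x + y) = y.
Proof. by rewrite addrA pt_addxx add0r. Qed.

Lemma pt_addCK x y : y + x + y = x.
Proof. by rewrite (addrC y) pt_addK. Qed.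

Lemma pt_addxyx x y z : x + y + (x + z) = y + z.
Proof. by rewrite addrACA pt_addxx add0r. Qed.

(** Over F_2 the affine combinations are the sums of an odd number of points, so these are the
    affine subspaces, the empty set included. *)
Definition flat A : bool :=
  [forall x in A, forall y in A, forall z in A, x + y + z \in A].

Lemma flatP A : reflect (forall x y z, x \in A -> y \in A -> z \in A -> x + y + z \in A)
  (flat A).
Proof.
apply: (iffP forall_inP) => [H x y z xA yA zA|H x xA].
  by move/forall_inP: (H x xA) => /(_ y yA)/forall_inP; apply.
by apply/forall_inP=> y yA; apply/forall_inP=> z zA; apply: H.
Qed.

Lemma flatT : flat [set: pt m].
Proof. by apply/flatP=> x y z _ _ _; rewrite inE. Qed.

Lemma flat1 x : flat [set x].
Proof. by apply/flatP=> ? ? ?; rewrite !inE => /eqP-> /eqP-> /eqP->; rewrite pt_addK. Qed.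

Definition translate v A : {set pt m} := [set (x : pt m) + v | x in A].

Lemma mem_translate v A x : (x \in translate v A) = (x + v \in A).
Proof.
apply/imsetP/idP=> [[y yA ->]|xA]; first by rewrite pt_addK.
by exists (x + v); rewrite ?pt_addK.
Qed.

Lemma card_translate v A : #|translate v A| = #|A|.
Proof. by rewrite card_imset //; apply: addIr. Qed.

Lemma flat_dir A x y z : flat A -> x \in A -> y \in A -> z \in A -> z + (x + y) \in A.
Proof. by move=> /flatP fA xA yA zA; rewrite addrA; apply: fA. Qed.

Lemma flat_translate v A : flat A -> flat (translate v A).
Proof.
move=> /flatP fA; apply/flatP=> x y z; rewrite !mem_translate => xA yA zA.
have -> : x + y + z + v = x + v + (y + v) + (z + v).
  by rewrite (addrACA x) pt_addxx addr0 addrA.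
exact: fA.
Qed.

Lemma flat_extend v A : flat A -> flat (A :|: translate v A).
Proof.
move=> /flatP fA; apply/flatP=> x y z; rewrite !inE !mem_translate.
have E1 (a b c : pt m) : a + v + b + c = a + b + c + v by rewrite (addrAC a) (addrAC _ v).
have E2 (a b c : pt m) : a + (b + v) + c = a + b + c + v by rewrite !addrA (addrAC _ v).
case/orP=> xA /orP[] yA /orP[] zA; have := fA _ _ _ xA yA zA;
  rewrite ?E1 ?E2 ?addrA ?pt_addK => ->; rewrite ?orbT //.
Qed.

End Points.

(** * Affine forms, hyperplanes and halves *)

Notation form m := (pt m * 'F_2)%type.

Section Forms.
Variable m : nat.
Implicit Types (x y z v : pt m) (A B S : {set pt m}) (a b : form m) (c : 'F_2).

(* Locked, so that rewriting with ring lemmas never looks inside a form. *)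
Definition aev a x : 'F_2 := locked (\sum_i a.1 i * x i + a.2).

Lemma aevE a x : aev a x = \sum_i a.1 i * x i + a.2.
Proof. by rewrite /aev -lock. Qed.

Lemma aevD a b x : aev (a + b) x = aev a x + aev b x.
Proof.
rewrite !aevE addrACA -big_split /=; congr (_ + _).
by apply: eq_bigr => i _; rewrite ffunE mulrDl.
Qed.

Lemma aev_const c x : aev (0, c) x = c.
Proof. by rewrite !aevE big1 ?add0r // => i _; rewrite ffunE mul0r. Qed.

Lemma aev_addpt a x y z : aev a (x + y + z) = aev a x + aev a y + aev a z.
Proof.
have E : \sum_i a.1 i * (x + y + z) i =
    \sum_i a.1 i * x i + \sum_i a.1 i * y i + \sum_i a.1 i * z i.
  by rewrite -!big_split /=; apply: eq_bigr => i _; rewrite !ffunE !mulrDr.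
rewrite !aevE E; move: (\sum_i _ * x i) (\sum_i _ * y i) (\sum_i _ * z i) (a.2).
by move=> p q r e; rewrite [p + e + _]addrACA F2_addxx addr0 addrA.
Qed.

(** Adding the constant [f 0] makes [f] additive; the coefficients are then its values on the unit
    vectors. *)
Lemma affine_form (f : pt m -> 'F_2) :
  (forall x y z, f (x + y + z) = f x + f y + f z) ->
  exists a, forall x, f x = aev a x.
Proof.
move=> fD; pose g x := f x + f 0.
have g0 : g 0 = 0 by rewrite /g F2_addxx.
have gD : {morph g : x y / x + y}.
  move=> x y; rewrite /g -[x + y]addr0 fD -!addrA; congr (_ + _).
  by rewrite F2_addxx addr0 addrCA F2_addxx addr0.
pose d i : pt m := [ffun j => (i == j)%:R].
exists ([ffun i => g (d i)], f 0) => x.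
have -> : f x = g x + f 0 by rewrite /g -addrA F2_addxx addr0.
rewrite aevE /=; congr (_ + _).
have {1}-> : x = \sum_i [ffun j => x i * (i == j)%:R].
  apply/ffunP=> j; rewrite sum_ffunE (bigD1 j) //= ffunE eqxx mulr1 big1 ?addr0 //.
  by move=> i /negbTE ij; rewrite ffunE ij mulr0.
rewrite (big_morph g gD g0); apply: eq_bigr => i _; rewrite ffunE.
case: (F2P (x i)) => ->.
  rewrite mulr0 -[RHS]g0; congr g; apply/ffunP=> j.
  by rewrite !ffunE mul0r.
by rewrite mulr1; congr g; apply/ffunP=> j; rewrite !ffunE mul1r.
Qed.

(* A maximal flat avoiding [x] has the translate through [x] as complement, so it is a hyperplane. *)
Lemma separation B x : flat B -> x \notin B ->
  exists a, (forall y, y \in B -> aev a y = 0) /\ aev a x = 1.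
Proof.
move=> fB xB.
have [-> | [b bB]] := set_0Vmem B.
  by exists (0, 1); split=> [y|]; rewrite ?inE // aev_const.
pose Q H := flat H && (x \notin H).
have QB : Q B by rewrite /Q fB.
have [H /maxsetP[/andP[fH xH] maxH] BH] := maxset_exists QB.
have bH := subsetP BH _ bB.
(* Adjoining to [H] its translate through [y] gives a strictly larger flat, which by maximality must
   contain [x]. *)
have hyp y : y \notin H -> y + (x + b) \in H.
  move=> yH; apply/negPn/negP=> yxH.
  have /maxH : Q (H :|: translate (y + b) H).
    rewrite /Q flat_extend //= !inE (negbTE xH) mem_translate /=.
    by apply: contra yxH; rewrite addrCA.
  move=> /(_ (subsetUl _ _))/setP/(_ y); rewrite inE mem_translate (negbTE yH).
  by rewrite addrA pt_addxx add0r bH.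
have hypE y : (y + (x + b) \in H) = (y \notin H).
  apply/idP/idP=> [h|/hyp//]; apply: contra xH => yH.
  by have := flat_dir fH h yH bH; rewrite (addrC _ y) pt_addKl addrA pt_addCK.
(* Every point lies in [H] up to a shift by [x + b], and only the parity of the number of shifts
   matters, so the indicator of the complement is affine. *)
pose chi y : 'F_2 := (y \notin H)%:R.
suff /affine_form[a aE] : forall u v w, chi (u + v + w) = chi u + chi v + chi w.
  by exists a; split=> [y /(subsetP BH) yH|]; rewrite -aE /chi ?yH // xH.
have fH' := flatP _ fH.
move=> u v w; rewrite /chi; move: (x + b) hyp hypE => k hyp hypE.
have key u' v' w' : u' \in H -> v' \in H -> w' \in H ->
  forall i j l : bool, ((if i then u' + k else u') + (if j then v' + k else v') +
     (if l then w' + k else w') \notin H) = i (+) j (+) l.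
  move=> uH vH wH i j l.
  have E1 (p q r : pt m) : p + k + q + r = p + q + r + k by rewrite (addrAC p) (addrAC _ k).
  have E2 (p q r : pt m) : p + (q + k) + r = p + q + r + k by rewrite !addrA (addrAC _ k).
  have suvw := fH' _ _ _ uH vH wH.
  by case: i j l => [] [] []; rewrite ?E1 ?E2 ?addrA ?pt_addK ?hypE suvw.
have rep y : exists2 y', y' \in H & y = if y \notin H then y' + k else y'.
  case: (boolP (y \in H)) => yH /=; first by exists y.
  by exists (y + k); rewrite ?hyp // pt_addK.
have [u' uH {1}->] := rep u; have [v' vH {1}->] := rep v; have [w' wH {1}->] := rep w.
rewrite key //; case: (u \notin H) (v \notin H) (w \notin H) => [] [] [];
 by apply/eqP.
Qed.

Definition half a c A : {set pt m} := [set x in A | aev a x == c].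
Definition splits a A : bool := (half a 0 A != set0) && (half a 1 A != set0).

Lemma in_half a c A x : (x \in half a c A) = (x \in A) && (aev a x == c).
Proof. by rewrite inE. Qed.

Lemma half_sub a c A : half a c A \subset A.
Proof. by apply/subsetP=> x; rewrite in_half => /andP[]. Qed.

Lemma flat_half a c A : flat A -> flat (half a c A).
Proof.
move=> /flatP fA; apply/flatP=> x y z; rewrite !in_half.
move=> /andP[xA /eqP xc] /andP[yA /eqP yc] /andP[zA /eqP zc].
by rewrite fA //= aev_addpt xc yc zc F2_addxx add0r.
Qed.

Lemma splits_neq0 a c A : splits a A -> half a c A != set0.
Proof. by case/andP; case: (F2P c) => ->. Qed.

Lemma splitsI a A x y : x \in A -> y \in A -> aev a x != aev a y -> splits a A.
Proof.
move=> xA yA.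
wlog x0 : x y xA yA / aev a x = 0.
  move=> H; case: (F2P (aev a x)) => E ne; first exact: H xA yA E ne.
  apply: (H y x) => //; last by rewrite eq_sym.
  by move: ne; rewrite E; case: (F2P (aev a y)) => ->.
rewrite x0 eq_sym F2_neq0 => y1; apply/andP.
by split; apply/set0Pn; [exists x|exists y]; rewrite in_half ?xA ?yA //= x0.
Qed.

Lemma half_card A a c : (#|half a c A| + #|half a (c + 1)%R A| = #|A|)%N.
Proof.
rewrite -(cardsID [set x | aev a x == c] A); congr (_ + _)%N; apply: eq_card => x.
  by rewrite !inE.
by rewrite !inE andbC -F2_neq.
Qed.

(** Translation by the sum of one point from each half exchanges the two halves. *)
Lemma card_half a c A : flat A -> splits a A -> (2 * #|half a c A| = #|A|)%N.
Proof.
move=> fA sA.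
have le c' : (#|half a (c' + 1)%R A| <= #|half a c' A|)%N.
  have /set0Pn[x xh] := splits_neq0 c' sA.
  have /set0Pn[y yh] := splits_neq0 (c' + 1) sA.
  move: xh yh; rewrite !in_half => /andP[xA /eqP xc] /andP[yA /eqP yc].
  rewrite -(card_translate (x + y) (half a c' A)); apply: subset_leq_card.
  apply/subsetP=> z; rewrite mem_translate !in_half => /andP[zA /eqP zc].
  rewrite flat_dir //= addrA !aev_addpt zc xc yc addrAC F2_addxx add0r eqxx //.
have le1 := le c; have := le (c + 1); rewrite -addrA F2_addxx addr0 => le2.
by rewrite -(half_card A a c); lia.
Qed.

Lemma card_half_lt a c A : flat A -> splits a A -> (#|half a c A| < #|A|)%N.
Proof.
move=> fA sA; rewrite -(card_half c fA sA) mul2n -addnn -[X in (X < _)%N]addn0.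
by rewrite ltn_add2l card_gt0 splits_neq0.
Qed.

Lemma exists_splits A x y : x \in A -> y \in A -> x != y -> exists a, splits a A.
Proof.
move=> xA yA xy; have [||a [a0 a1]] := @separation [set x] y; rewrite ?flat1 ?inE 1?eq_sym //.
by exists a; apply: (splitsI xA yA); rewrite a1 a0 ?inE.
Qed.

Lemma card_gt1_splits A : (1 < #|A|)%N -> exists a, splits a A.
Proof. by case/card_gt1P=> x [y [xA yA xy]]; apply: exists_splits xA yA xy. Qed.

End Forms.


(** * Minimum weight *)

Section Degree.
Variable m : nat.
Implicit Types (x y z v : pt m) (A B S : {set pt m}) (a b : form m) (c : 'F_2).
Implicit Types (f g : pt m -> 'F_2) (n r : nat).

Definition deriv v f x : 'F_2 := f x + f (x + v).

(* Only the directions [v] that preserve [A] are used, so this bounds the degree of [f] as a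
   function on the flat [A]. *)
Fixpoint deg_lt n f A : Prop :=
  if n is n'.+1 then
    forall v, (forall x, x \in A -> x + v \in A) -> deg_lt n' (deriv v f) A
  else forall x, x \in A -> f x = 0.

Lemma deg_lt_ext n f g A : (forall x, x \in A -> f x = g x) -> deg_lt n f A -> deg_lt n g A.
Proof.
elim: n f g => [|n IH] f g fg /= d; first by move=> x xA; rewrite -fg ?d.
by move=> v vA; apply: IH (d v vA) => x xA; rewrite /deriv !fg ?vA.
Qed.

Lemma deg_lt_set0 n f : deg_lt n f set0.
Proof. by elim: n f => [|n IH] f /= => [x|v _]; rewrite ?inE. Qed.

(** A direction preserving a nonempty [B] is a sum of two points of the flat [A], hence preserves
    [A] as well. *)
Lemma deg_lt_sub n f A B : flat A -> B \subset A -> deg_lt n f A -> deg_lt n f B.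
Proof.
move=> fA BA; have [->|[b bB]] := set_0Vmem B; first by move=> _; apply: deg_lt_set0.
elim: n f => [|n IH] f /= d; first by move=> x /(subsetP BA)/d.
move=> v vB; apply/IH/d => x xA.
have := flat_dir fA (subsetP BA _ bB) (subsetP BA _ (vB _ bB)) xA.
by rewrite pt_addKl.
Qed.

Lemma deg_lt0 n f A : (forall x, x \in A -> f x = 0) -> deg_lt n f A.
Proof.
elim: n f => //= n IH f f0 v vA; apply: IH => x xA.
by rewrite /deriv !f0 ?vA ?addr0.
Qed.

Lemma deg_ltD n f g A : deg_lt n f A -> deg_lt n g A -> deg_lt n (fun x => f x + g x) A.
Proof.
elim: n f g => [|n IH] f g /= df dg; first by move=> x xA; rewrite df ?dg ?addr0.
move=> v vA; apply: deg_lt_ext (IH _ _ (df v vA) (dg v vA)) => x xA.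
by rewrite /deriv addrACA.
Qed.

Lemma deg_ltS n f A : deg_lt n f A -> deg_lt n.+1 f A.
Proof.
elim: n f => [|n IH] f df v vA; last exact/IH/df.
by move=> x xA; rewrite /deriv !df ?vA ?addr0.
Qed.

Lemma deg_ltW n n' f A : (n <= n')%N -> deg_lt n f A -> deg_lt n' f A.
Proof. by move=> /subnK <- d; elim: (n' - n)%N => // k; apply: deg_ltS. Qed.

Lemma deg_lt_const n c A : deg_lt n.+1 (fun=> c) A.
Proof. by move=> v _; apply: deg_lt0 => x _; rewrite /deriv F2_addxx. Qed.

Lemma deg_lt_shift n f A v : (forall x, x \in A -> x + v \in A) ->
  deg_lt n f A -> deg_lt n (fun x => f (x + v)) A.
Proof.
move=> vA df.
have : deg_lt n (fun x => f x + deriv v f x) A.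
  apply: deg_ltD (df) _; case: n df => [|n] df; last exact/deg_ltS/df.
  by move=> x xA; rewrite /deriv !df ?vA ?addr0.
by apply: deg_lt_ext => x _; rewrite /deriv addrA F2_addxx add0r.
Qed.

Lemma deg_lt_scale n c f A : deg_lt n f A -> deg_lt n (fun x => c * f x) A.
Proof.
case: (F2P c) => -> df; last by apply: deg_lt_ext df => x _; rewrite mul1r.
by apply: deg_lt0 => x _; rewrite mul0r.
Qed.

(** Product rule: the derivative of the product along [v] is [a] times the derivative of [f], plus a
    constant times a shift of [f]. *)
Lemma deg_lt_mulform n a f A : deg_lt n f A -> deg_lt n.+1 (fun x => aev a x * f x) A.
Proof.
elim: n f => [|n IH] f df.
  by apply: deg_lt0 => x xA; rewrite df ?mulr0.
move=> v vA.
have av x : aev a (x + v) = aev a x + (aev a 0 + aev a v).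
  by rewrite -[x + v in LHS](addr0 _) aev_addpt -addrA [aev a v + _]addrC.
have := deg_ltD (IH _ (df v vA)) (deg_lt_scale (aev a 0 + aev a v) (deg_lt_shift vA df)).
apply: deg_lt_ext => x _; by rewrite /deriv av mulrDr !mulrDl !addrA.
Qed.

Lemma deg_lt_form a A : deg_lt 2 (aev a) A.
Proof.
have := deg_lt_mulform a (@deg_lt_const 0 1 A).
by apply: (@deg_lt_ext 2) => x _; rewrite mulr1.
Qed.

Definition supp f A : {set pt m} := [set x in A | f x != 0].

Lemma in_supp f A x : (x \in supp f A) = (x \in A) && (f x != 0).
Proof. by rewrite inE. Qed.

Lemma supp_sub f A : supp f A \subset A.
Proof. by apply/subsetP=> x; rewrite in_supp => /andP[]. Qed.

Lemma supp_half f a c A : supp f (half a c A) = half a c (supp f A).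
Proof. by apply/setP=> x; rewrite !inE andbAC. Qed.

Lemma card_supp_half f a c A :
  (#|supp f (half a c A)| + #|supp f (half a (c + 1)%R A)| = #|supp f A|)%N.
Proof. by rewrite !supp_half half_card. Qed.

(** Along a direction crossing the two halves, the derivative of [f] on the second half is [f]
    itself, so the degree bound drops by one there. *)
Lemma deg_lt_half0 n f A a c : flat A -> splits a A -> deg_lt n.+1 f A ->
  supp f (half a c A) = set0 -> deg_lt n f (half a (c + 1) A).
Proof.
move=> fA sA df s0.
have /set0Pn[x] := splits_neq0 c sA; have /set0Pn[y] := splits_neq0 (c + 1) sA.
rewrite !in_half => /andP[yA /eqP yc] /andP[xA /eqP xc].
have vA z : z \in A -> z + (x + y) \in A by apply: flat_dir.
apply: deg_lt_ext (deg_lt_sub fA (half_sub a (c + 1) A) (df _ vA)) => z.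
rewrite in_half => /andP[zA /eqP zc].
have : z + (x + y) \notin supp f (half a c A) by rewrite s0 inE.
rewrite in_supp in_half vA // addrA aev_addpt xc yc zc.
have -> : (c + 1 + c + (c + 1) == c) by case: (F2P c) => ->.
by rewrite negbK /deriv -addrA => /eqP->; rewrite addr0.
Qed.

(** The Reed-Muller minimum distance, by induction on the size of [A]. If [f] vanishes on a half,
    the degree bound drops on the other one; otherwise the bounds for the two halves add up. *)
Theorem min_weight r f A : flat A -> deg_lt r.+1 f A -> supp f A != set0 ->
  (#|A| <= 2 ^ r * #|supp f A|)%N.
Proof.
have [n] := ubnP #|A|; elim: n => // n IH in r f A * => le_n fA df sf.
have s1 : (0 < #|supp f A|)%N by rewrite card_gt0.
case: (leqP #|A| 1) => [A1|/card_gt1_splits[a sA]].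
  by apply: leq_trans A1 _; rewrite muln_gt0 expn_gt0.
have ca c := card_half c fA sA.
have cs c := card_supp_half f a c A.
have lt_n c : (#|half a c A| < n)%N := leq_trans (card_half_lt c fA sA) le_n.
case: (boolP [exists c, supp f (half a c A) == set0]) => [/existsP[c /eqP s0]|].
  have d1 := deg_lt_half0 fA sA df s0.
  have := cs c; rewrite s0 cards0 => {}cs.
  have sf1 : supp f (half a (c + 1) A) != set0 by rewrite -card_gt0; lia.
  case: r df d1 => [|r] df d1.
    case/set0Pn: sf1 => x; rewrite in_supp => /andP[xA]; by rewrite d1.
  have := IH _ _ _ (lt_n _) (flat_half _ _ fA) d1 sf1.
  by rewrite -cs -(ca (c + 1)) expnS; lia.
rewrite negb_exists => /forallP sne.
have I c := IH _ _ _ (lt_n c) (flat_half _ _ fA) (deg_lt_sub fA (half_sub a c A) df) (sne c).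
have := leq_add (I 0) (I (0 + 1)); rewrite -mulnDr cs half_card; exact.
Qed.

(** Equality in the bound passes to halves, so three support points can be followed into smaller and
    smaller halves containing them, until [A] has at most four points. *)
Theorem min_weight_flat r f A : flat A -> deg_lt r.+1 f A ->
  (#|A| = 2 ^ r * #|supp f A|)%N -> flat (supp f A).
Proof.
have [n] := ubnP #|A|; elim: n => // n IH in r f A * => le_n fA df eqA.
apply/flatP=> x y z xS yS zS.
have SA := subsetP (supp_sub f A).
have [[xA yA] zA] := (SA _ xS, SA _ yS, SA _ zS).
case: (eqVneq x y) => [->|xy]; first by rewrite pt_addxx add0r.
case: (eqVneq x z) => [->|xz]; first by rewrite pt_addCK.
case: (eqVneq y z) => [->|yz]; first by rewrite pt_addK.
(* [B] is the flat spanned by [x], [y] and [z]; it has at most four points. *)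
pose B1 := [set x] :|: translate (x + y) [set x].
pose B := B1 :|: translate (x + z) B1.
have fB : flat B by rewrite !flat_extend ?flat1.
have xB : x \in B by rewrite !inE eqxx.
have yB : y \in B by rewrite !inE !mem_translate !inE (addrC x) pt_addKl eqxx orbT.
have zB : z \in B by rewrite !inE !mem_translate !inE [z + (x + z)]addrC pt_addK eqxx !orbT.
have cB : (#|B| <= 4)%N.
  apply: leq_trans (leq_card_setU _ _) _; rewrite card_translate.
  have leB1 : (#|B1| <= 2)%N.
    by apply: leq_trans (leq_card_setU _ _) _; rewrite card_translate cards1.
  exact: (leq_add leB1 leB1).
clearbody B.
have xyzA : x + y + z \in A by apply: (flatP _ fA).
case: (boolP (A \subset B)) => [AB|/subsetPn[u uA uB]].
  (* With three support points among at most four, equality forces [r = 0], so the support is all of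
     [A]. *)
  have s3 : (3 <= #|supp f A|)%N.
    have : uniq [:: x; y; z] by rewrite /= !inE negb_or xy xz yz.
    move/card_uniqP => /= <-; apply: subset_leq_card; apply/subsetP=> t.
    by rewrite !inE => /or3P[] /eqP->; rewrite -?in_supp -?[_ && _]in_supp.
  have := leq_trans (subset_leq_card AB) cB; rewrite eqA.
  case: r df eqA => [|r] df eqA.
    move=> _; suff -> : supp f A = A by [].
    by apply/eqP; rewrite eqEcard supp_sub eqA mul1n leqnn.
  rewrite expnS => le4; suff : (6 <= 4)%N by [].
  apply: leq_trans le4; rewrite -[6%N]/(2 * 1 * 3)%N.
  by rewrite leq_mul // leq_mul // expn_gt0.
have [a [a0 a1]] := separation fB uB.
have sA : splits a A by apply: (splitsI xA uA); rewrite a0 ?a1.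
have ca c := card_half c fA sA.
have cs c := card_supp_half f a c A.
have lt_n c : (#|half a c A| < n)%N := leq_trans (card_half_lt c fA sA) le_n.
have in0 t : t \in B -> t \in supp f A -> t \in supp f (half a 0 A).
  by move=> tB; rewrite supp_half in_half => ->; rewrite a0 ?eqxx.
suff fS : flat (supp f (half a 0 A)).
  have := flatP _ fS x y z (in0 _ xB xS) (in0 _ yB yS) (in0 _ zB zS).
  by rewrite supp_half in_half => /andP[].
case: (set_0Vmem (supp f (half a 1 A))) => [s0|[t tS]].
  have d1 := deg_lt_half0 fA sA df s0.
  have h0 : (1 + 1 : 'F_2) = 0 by apply/eqP.
  rewrite h0 in d1.
  have := cs 1; rewrite h0 s0 cards0 => {}cs.
  case: r df eqA d1 => [|r] df eqA d1.
    by have := in0 x xB xS; rewrite in_supp => /andP[xh]; rewrite d1.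
  apply: (IH r) => //; first exact: flat_half.
  by have /eqP := ca 0; rewrite eqA expnS -cs add0n -mulnA eqn_pmul2l // => /eqP.
have sne c : supp f (half a c A) != set0.
  by case: (F2P c) => ->; apply/set0Pn; [exists x; apply: in0 | exists t].
(* Both halves satisfy the bound and the bounds add up to an equality, so each half attains it. *)
have I c := min_weight (flat_half a c fA) (deg_lt_sub fA (half_sub a c A) df) (sne c).
apply: (IH r) => //; [exact: flat_half | exact: deg_lt_sub (half_sub _ _ _) df | ].
move: (I 0) (I 1) (ca 0) (ca 1); rewrite eqA -(cs 0) add0r mulnDr.
move: (2 ^ r * _)%N (2 ^ r * _)%N #|half a 0 A| #|half a 1 A|; clear; lia.
Qed.

End Degree.


(** * The weight gap *)

Section Gap.
Variable m : nat.
Implicit Types (x y z v : pt m) (A B S : {set pt m}) (a b : form m) (c d : 'F_2).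
Implicit Types (f g : pt m -> 'F_2) (n r : nat).

Lemma half_halfC a c b d S : half a c (half b d S) = half b d (half a c S).
Proof. by apply/setP=> x; rewrite !in_half andbAC. Qed.

Lemma half_halfD a c b d S : half (a + b) (c + d) (half a c S) = half b d (half a c S).
Proof.
apply/setP=> x; rewrite !in_half aevD.
by case: (eqVneq (aev a x) c) => [->|]; rewrite ?andbF //= (inj_eq (addrI c)).
Qed.

Lemma card_halfD a b c d S :
  #|half (a + b) d S| = (#|half b (c + d)%R (half a c S)| +
    #|half b (c + d + 1)%R (half a (c + 1)%R S)|)%N.
Proof.
rewrite -(half_card _ a c) !(half_halfC a) -(half_halfD a c b) -(half_halfD a (c + 1) b).
by rewrite !addrA F2_addxx add0r; congr (_ + #|half _ _ _|)%N; case: (F2P c) (F2P d) => -> [] ->; apply/eqP.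
Qed.

Lemma splits_sub a A B : flat A -> B \subset A -> splits a B -> splits a A.
Proof.
move=> fA /subsetP BA /andP[/set0Pn[x]] + /set0Pn[y].
rewrite !in_half => /andP[xB /eqP x0] /andP[yB /eqP y1].
by apply: (splitsI (BA _ xB) (BA _ yB)); rewrite x0 y1.
Qed.

(** The forms [a] and [b] cut [S] into four quarters, one of them empty; the halves of [b] and of
    [a + b] regroup the other three. *)
Lemma quarters S a b c : (forall x, x \in half a c S -> aev b x = 0) ->
  [/\ #|half b 0%R S| = (#|half a c S| + #|half b 0%R (half a (c + 1)%R S)|)%N,
      #|half b 1%R S| = #|half b 1%R (half a (c + 1)%R S)|,
      #|half (a + b)%R c S| = (#|half a c S| + #|half b 1%R (half a (c + 1)%R S)|)%N &
      #|half (a + b)%R (c + 1)%R S| = #|half b 0%R (half a (c + 1)%R S)|].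
Proof.
move=> b0.
have E0 : half b 0 (half a c S) = half a c S.
  by apply/setP=> x; rewrite in_half andb_idr // => /b0->.
have E1 : half b 1 (half a c S) = set0.
  by apply/setP=> x; rewrite in_half in_set0; apply/negP=> /andP[/b0->].
split.
- by rewrite -(half_card _ a c) !(half_halfC a) E0.
- by rewrite -(half_card _ a c) !(half_halfC a) E1 cards0.
- by rewrite (card_halfD a b c) !F2_addxx E0 add0r.
- rewrite (card_halfD a b c) !addrA !F2_addxx !add0r E1 cards0 F2_addxx //.
Qed.

(** If no half misses the support, all lighter halves have the same weight; comparing the halves of
    [a], [b] and [a + b] then forces the support to be at least three times as large, against the
    assumption. *)
Theorem weight_gap r f A : flat A -> deg_lt r.+1 f A -> supp f A != set0 ->
  (2 * (2 ^ r * #|supp f A|) < 3 * #|A|)%N -> (#|A| = 2 ^ r * #|supp f A|)%N.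
Proof.
have [n] := ubnP #|A|; elim: n => // n IH in r f A * => le_n fA df sf small.
have s1 : (0 < #|supp f A|)%N by rewrite card_gt0.
have mw := min_weight fA df sf.
case: r df mw small => [|r] df mw small.
  apply/eqP; rewrite eqn_leq mw mul1n; exact/subset_leq_card/supp_sub.
case: (leqP #|A| 1) => [A1|/card_gt1_splits[a sA]].
  move: small; rewrite expnS; have := leq_mul (expn_gt0 2 r) s1; rewrite /= mul1n -mulnA.
  by move: (2 ^ r * _)%N #|A| A1; clear; lia.
have fh b d := flat_half b d fA.
case: (boolP [exists b, splits b A && [exists d, supp f (half b d A) == set0]]).
  case/existsP=> b /andP[sb /existsP[d /eqP s0]].
  have d1 := deg_lt_half0 fA sb df s0.
  have cs := card_supp_half f b d A; rewrite s0 cards0 add0n in cs.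
  have cb := card_half (d + 1) fA sb.
  rewrite -cb -cs expnS -mulnA; congr (_ * _)%N; apply: IH => //.
  - exact: leq_trans (card_half_lt _ fA sb) le_n.
  - by rewrite -card_gt0 cs.
  - by move: small; rewrite expnS -cb -cs -mulnA !(mulnCA _ 2) ltn_pmul2l.
rewrite negb_exists => /forallP /= sne.
have ne b d : splits b A -> (0 < #|half b d (supp f A)|)%N.
  move=> sb; move: (sne b); rewrite sb /= negb_exists => /forallP/(_ d).
  by rewrite supp_half card_gt0.
(* By induction, a half carrying at most half of the support attains its own minimum weight, so all
   such halves carry equally many support points. *)
have key b d : splits b A -> (2 * #|half b d (supp f A)| <= #|supp f A|)%N ->
    (#|A| = 2 * (2 ^ r.+1 * #|half b d (supp f A)|))%N.
  move=> sb le; have cb := card_half d fA sb.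
  rewrite -cb -supp_half; congr (_ * _)%N; apply: IH.
  - exact: leq_trans (card_half_lt _ fA sb) le_n.
  - exact: fh.
  - exact: deg_lt_sub (half_sub _ _ _) df.
  - by rewrite supp_half -card_gt0 ne.
  - move: small; rewrite -cb supp_half.
    have : (2 * (2 ^ r.+1 * #|half b d (supp f A)|) <= 2 ^ r.+1 * #|supp f A|)%N.
      by rewrite mulnCA leq_mul2l le orbT.
    move: #|half b d A| (2 ^ r.+1 * #|half b d (supp f A)|)%N (2 ^ r.+1 * #|supp f A|)%N.
    by clear; lia.
have [c lec] : exists c, (2 * #|half a c (supp f A)| <= #|supp f A|)%N.
  case: (leqP (2 * #|half a 0%R (supp f A)|) #|supp f A|); first by exists 0.
  move=> lt0; exists (0 + 1); move: lt0; rewrite -(half_card (supp f A) a 0).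
  by move: #|half a 0%R _| #|half a (0 + 1)%R _|; clear; lia.
have Fc := key _ _ sA lec.
have fF : flat (supp f (half a c A)).
  apply: min_weight_flat (fh a c) (deg_lt_sub fA (half_sub _ _ _) df) _.
  by apply/eqP; rewrite -(eqn_pmul2l (isT : 0 < 2)%N) (card_half _ fA sA) Fc supp_half.
have : ~~ (half a c A \subset supp f (half a c A)).
  apply/negP=> /subset_leq_card; rewrite -(leq_pmul2l (isT : 0 < 2)%N) (card_half _ fA sA).
  rewrite Fc supp_half expnS -mulnA; have := ne a c sA; have : (#|half a c (supp f A)| <= 2 ^ r * #|half a c (supp f A)|)%N.
    by rewrite leq_pmull // expn_gt0.
  by move: #|half a c (supp f A)| (2 ^ r * _)%N; clear; lia.
(* [b] vanishes on the support in the light half of [a] without being constant on that half, so [b]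
   and [a + b] split [A] too. *)
case/subsetPn => u uA0 uF; have [b [b0 b1]] := separation fF uF.
have [p pF] : exists p, p \in supp f (half a c A).
  by apply/card_gt0P; rewrite supp_half ne.
have pA0 := subsetP (supp_sub _ _) _ pF.
have sb0 : splits b (half a c A) by apply: (splitsI pA0 uA0); rewrite b0 ?b1.
have sb := splits_sub fA (half_sub _ _ _) sb0.
have sab : splits (a + b) A.
  apply: splits_sub fA (half_sub a c A) _; apply: (splitsI pA0 uA0).
  move: pA0 uA0; rewrite !in_half !aevD b0 // b1 => /andP[_ /eqP->] /andP[_ /eqP->].
  by case: (F2P c) => ->.
have b0' x : x \in half a c (supp f A) -> aev b x = 0 by rewrite -supp_half; apply: b0.
have [q1 q2 q3 q4] := quarters b0'.
have keyF b' d k : splits b' A -> #|half b' d (supp f A)| = k -> (2 * k <= #|supp f A|)%N ->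
    k = #|half a c (supp f A)|.
  move=> sb' <- le; apply/eqP; rewrite -(eqn_pmul2l (expn_gt0 2 r.+1 : (0 < 2 ^ r.+1)%N)).
  by rewrite -(eqn_pmul2l (isT : 0 < 2)%N) -Fc -key.
have := half_card (supp f A) b 0; rewrite add0r q1 q2 => cS.
(* The two remaining quarters are nonempty; each must be the lighter half of its form, hence as
   large as the first. *)
have W3 : (3 * #|half a c (supp f A)| <= #|supp f A|)%N.
  move: (keyF _ _ _ sb q1) (keyF _ _ _ sb q2) (keyF _ _ _ sab q3) (keyF _ _ _ sab q4).
  have := ne b 1 sb; have := ne _ (c + 1) sab; rewrite q2 q4.
  move: cS.
  move: #|half b 1%R (half _ _ _)| #|half b 0%R (half _ _ _)| #|half a c _| #|supp f A|.
  by clear; lia.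
have : (3 * (2 ^ r.+1 * #|half a c (supp f A)|) <= 2 ^ r.+1 * #|supp f A|)%N.
  by rewrite mulnCA leq_mul2l W3 orbT.
move: small; rewrite Fc.
move: (2 ^ r.+1 * #|half a c (supp f A)|)%N (2 ^ r.+1 * #|supp f A|)%N; clear; lia.
Qed.

(** The hypothesis passes to larger flats, so by induction every flat strictly between [B] and [A],
    and [A] itself, meets [S] in the right proportion; four of them determine the count on [B]. If
    [B] is half of [A], the hypothesis gives the count directly. *)
Theorem balanced_flat S A B : flat A -> flat B -> B \subset A -> B != set0 -> S \subset A ->
  (forall b, (forall x, x \in B -> aev b x = 0) -> splits b A -> #|half b 0%R S| = #|half b 1%R S|) ->
  (#|S :&: B| * #|A| = #|S| * #|B|)%N.
Proof.
move=> fA; have [n] := ubnP (#|A| - #|B|)%N; elim: n => // n IH in B *.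
move=> le_n fB BA B0 SA bal.
have [AB|/subsetPn[u uA uB]] := boolP (A \subset B).
  have -> : B = A by apply/eqP; rewrite eqEsubset BA.
  by rewrite (setIidPl SA).
have Ap : (0 < #|B|)%N by rewrite card_gt0.
case/set0Pn: B0 => x xB; have xA := subsetP BA _ xB.
have [b [b0 b1]] := separation fB uB.
have ext C t e : flat C -> C \subset A -> B \subset C -> t \in A -> (forall y, y \in C -> aev e y = 0) -> aev e t = 1 ->
    let D := C :|: translate (x + t) C in
    [/\ flat D, D \subset A, B \subset D, C = half e 0 D & #|D| = (2 * #|C|)%N].
  move=> fC CA BC tA e0 e1 D.
  have xC := subsetP BC _ xB.
  have fD : flat D by apply: flat_extend.
  have eh : C = half e 0 D.
    apply/setP=> y; rewrite in_half in_setU mem_translate.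
    case: (boolP (y \in C)) => yC /=; first by rewrite e0.
    apply/esym/negP=> /andP[yC' /eqP ey]; move/e0: yC'.
    by rewrite addrA aev_addpt ey e1 (e0 x).
  have sD : splits e D.
    apply: (@splitsI _ _ _ x t); rewrite ?e1 ?(e0 x) //; first by rewrite in_setU xC.
    by rewrite in_setU mem_translate [t + _]addrC pt_addK xC orbT.
  split=> //; last by rewrite {1}eh card_half.
    rewrite subUset CA; apply/subsetP=> y; rewrite mem_translate => /(subsetP CA) yA.
    by have := flat_dir fA xA tA yA; rewrite pt_addK.
  exact: subset_trans BC (subsetUl _ _).
pose C := B :|: translate (x + u) B.
have [fC CA BC eB cC] := ext B u b fB BA (subxx _) uA b0 b1; rewrite -/C in fC CA BC eB cC.
have [AC|/subsetPn[w wA wC]] := boolP (A \subset C).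
  have eC : C = A by apply/eqP; rewrite eqEsubset CA.
  have sb : splits b A by apply: (splitsI xA uA); rewrite b0 ?b1.
  have := bal b b0 sb; have := half_card S b 0; rewrite add0r.
  have -> : S :&: B = half b 0 S.
    apply/setP=> y; rewrite in_setI eB !in_half; case: (boolP (y \in S)) => //= yS.
    by rewrite eC (subsetP SA).
  rewrite -eC cC; move: #|half _ _ _| #|half _ _ _| #|S| #|B|; clear; lia.
have [e [e0 e1]] := separation fC wC.
pose D := C :|: translate (x + w) C.
have [fD DA BD eC cD] := ext C w e fC CA BC wA e0 e1; rewrite -/D in fD DA BD eC cD.
have xC := subsetP BC _ xB.
have uC : u \in C by rewrite in_setU mem_translate [u + _]addrC pt_addK xB orbT.
have CD : C \subset D := subsetUl _ _.
have [xD uD] : x \in D /\ u \in D by split; apply: (subsetP CD).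
have sbD : splits b D by apply: (splitsI xD uD); rewrite b0 ?b1.
have sbeD : splits (b + e) D by apply: (splitsI xD uD); rewrite !aevD b0 // b1 !e0.
have step E : flat E -> E \subset A -> B \subset E -> (#|B| < #|E|)%N ->
    (#|S :&: E| * #|A| = #|S| * #|E|)%N.
  move=> fE EA BE lt; apply: IH => //.
  - have := subset_leq_card EA; move: le_n lt; clear; lia.
  - by apply/set0Pn; exists x; apply: (subsetP BE).
  - by move=> b' b'0; apply: bal => y /(subsetP BE)/b'0.
have zeroB (b' : form m) : (forall y, y \in B -> aev b' y = 0) -> B \subset half b' 0 D.
  by move=> b'0; apply/subsetP=> y yB; rewrite in_half (subsetP BD) // b'0 ?eqxx.
have stepH b' : splits b' D -> (forall y, y \in B -> aev b' y = 0) ->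
    (#|S :&: half b' 0%R D| * #|A| = #|S| * (2 * #|B|))%N.
  move=> sb' b'0; have ch : #|half b' 0%R D| = (2 * #|B|)%N.
    have /eqP := card_half 0 fD sb'; rewrite cD cC eqn_pmul2l // => /eqP-> //.
  rewrite -ch; apply: step; rewrite ?flat_half ?zeroB //.
    exact: subset_trans (half_sub _ _ _) DA.
  by rewrite ch; move: Ap; clear; lia.
have e0B y : y \in B -> aev e y = 0 by move/(subsetP BC)/e0.
(* The three halves of [D] through [B] cover [D] and meet pairwise in [B], so their counts add up to
   that of [D] plus twice that of [B]. *)
have h1 := stepH b sbD b0.
have h2 : (#|S :&: half (b + e)%R 0%R D| * #|A| = #|S| * (2 * #|B|))%N.
  by apply: stepH => // y yB; rewrite aevD b0 // e0B // addr0.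
have h3 : (#|S :&: half e 0%R D| * #|A| = #|S| * (2 * #|B|))%N.
  rewrite -eC -cC; apply: step => //; rewrite cC; move: Ap; clear; lia.
have h4 : (#|S :&: D| * #|A| = #|S| * (4 * #|B|))%N.
  have -> : (4 * #|B| = #|D|)%N by rewrite cD cC mulnA.
  apply: step => //; rewrite cD cC; move: Ap; clear; lia.
have hI e' : S :&: half e' 0 D = half e' 0 (S :&: D) by apply/setP=> y; rewrite !inE andbA.
have eBq : S :&: B = half e 0 (half b 0 (S :&: D)).
  by rewrite eB eC half_halfC; apply/setP=> y; rewrite !inE !andbA.
rewrite !hI in h1 h2 h3; rewrite eBq.
move: (S :&: D) h1 h2 h3 h4 => T; rewrite (card_halfD b e 0 0) !add0r.
have -> : #|half e 0 T| = (#|half e 0%R (half b 0%R T)| + #|half e 0%R (half b 1%R T)|)%N.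
  by rewrite -(half_card (half e 0 T) b 0) !(half_halfC b) add0r.
have E c : #|half b c T| = (#|half e 0%R (half b c T)| + #|half e 1%R (half b c T)|)%N.
  by rewrite -(half_card (half b c T) e 0) add0r.
rewrite -(half_card T b 0) add0r !E.
move: #|half _ _ (half _ _ _)| #|half _ _ (half _ _ _)| #|half _ _ (half _ _ _)| #|half _ _ (half _ _ _)|.
by move: #|S| #|A| #|B|; clear; lia.
Qed.

End Gap.


(** * Weight three halves of the minimum *)

Section Core.
Variable m : nat.
Implicit Types (x y z v : pt m) (A B S F : {set pt m}) (a b : form m) (c d : 'F_2).
Implicit Types (f g : pt m -> 'F_2) (n r : nat).

(** If every hyperplane halved [S], then [balanced_flat] at a single point of [S] would give [S]
    density one. *)
Lemma unbalanced S A : flat A -> S \subset A -> S != set0 -> (#|S| < #|A|)%N ->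
  exists a c, splits a A /\ (2 * #|half a c S| < #|S|)%N.
Proof.
move=> fA SA /set0Pn[x xS] ltSA.
case: (boolP [exists a, exists c, splits a A && (2 * #|half a c S| < #|S|)%N]).
  by case/existsP=> a /existsP[c /andP[sa lt]]; exists a, c.
rewrite negb_exists => /forallP /= H.
suff : (#|S :&: [set x]| * #|A| = #|S| * #|[set x]|)%N.
  have -> : S :&: [set x] = [set x] by apply/setIidPr; rewrite sub1set.
  by rewrite cards1 mul1n muln1 => E; move: ltSA; rewrite E ltnn.
apply: balanced_flat => //; rewrite ?flat1 ?sub1set ?(subsetP SA) //.
  by apply/set0Pn; exists x; rewrite inE.
move=> b _ sb; have := H b; rewrite negb_exists => /forallP h.
have := h 0; have := h 1; rewrite sb /= -!leqNgt; have := half_card S b 0; rewrite add0r.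
by move: #|half b 0 S| #|half b 1 S| #|S|; clear; lia.
Qed.

Lemma half_const b c d S : half (b + (0, c)) d S = half b (d + c) S.
Proof.
apply/setP=> x; rewrite !in_half aevD aev_const; congr andb.
by case: (F2P c) (F2P d) (F2P (aev b x)) => -> [] -> [] ->.
Qed.

Lemma splits_const b c A : splits (b + (0, c)) A = splits b A.
Proof.
rewrite /splits !half_const; case: (F2P c) => ->; rewrite !(add0r, addr0) //.
by rewrite F2_addxx andbC.
Qed.

Lemma supp_flat_translate f F t : supp f (translate t F) = translate t (supp (fun x => f (x + t)) F).
Proof. by apply/setP=> x; rewrite !(in_supp, mem_translate) pt_addK. Qed.

(* Every form [b] that is constant on [F] must split the points of [supp f A]
   outside the half of [a] evenly, because [b] and [a + b] both obey the gap. *)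
Lemma minimal_half r f A : flat A -> deg_lt r.+2 f A -> A != set0 ->
    (2 * (2 ^ r.+1 * #|supp f A|) = 3 * #|A|)%N ->
    (forall b d, splits b A -> supp f (half b d A) != set0) ->
  exists a c, let F := supp f (half a c A) in
  [/\ splits a A, flat F, #|half a c A| = (2 ^ r.+1 * #|F|)%N,
      #|supp f (half a (c + 1) A)| = (2 * #|F|)%N &
      forall t, (forall x, x \in F -> x + t \in half a (c + 1) A) ->
        (2 ^ r.+1 * #|supp (fun x => f (x + t)%R) F| = 2 * #|F|)%N].
Proof.
move=> fA df A0 W ne; set S := supp f A.
have Ap : (0 < #|A|)%N by rewrite card_gt0.
have Sp : (0 < #|S|)%N.
  by rewrite lt0n; apply/eqP=> S0; move: W; rewrite -/S S0; move: Ap; clear; lia.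
have ltSA : (#|S| < #|A|)%N.
  move: W Sp; rewrite -/S expnS => W Sp.
  have le : (#|S| <= 2 ^ r * #|S|)%N by rewrite leq_pmull // expn_gt0.
  by move: W le Sp; rewrite -mulnA; move: #|S| (2 ^ r * _)%N #|A|; clear; lia.
have key b d : splits b A -> (2 * #|half b d S| < #|S|)%N ->
    #|half b d A| = (2 ^ r.+1 * #|half b d S|)%N.
  move=> sb lt; rewrite -supp_half; apply: weight_gap => //; first exact: flat_half.
  - exact: deg_lt_sub (half_sub _ _ _) df.
  - exact: ne.
  - have cb := card_half d fA sb; move: W; rewrite -cb supp_half -/S mulnCA (mulnCA 3).
    move/eqP; rewrite mulnCA eqn_pmul2l // => /eqP W.
    by rewrite -W mulnCA ltn_pmul2l // expn_gt0.
have S0 : S != set0 by rewrite -card_gt0.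
have [a [c [sa lt]]] := unbalanced fA (supp_sub f A) S0 ltSA.
have Fc := key _ _ sa lt.
exists a, c => F; have cF : #|F| = #|half a c S| by rewrite /F supp_half.
have fF : flat F.
  apply: min_weight_flat (flat_half _ _ fA) (deg_lt_sub fA (half_sub _ _ _) df) _.
  by rewrite Fc -cF.
have W3 : (#|S| = 3 * #|F|)%N.
  apply/eqP; rewrite -(eqn_pmul2l (expn_gt0 2 r.+1 : (0 < 2 ^ r.+1)%N)).
  rewrite -(eqn_pmul2l (isT : 0 < 2)%N) W -(card_half c fA sa) Fc -cF.
  by rewrite (mulnCA 3) (mulnCA 3).
have F1 : (0 < #|F|)%N by rewrite card_gt0 ne.
have S1 : #|supp f (half a (c + 1) A)| = (2 * #|F|)%N.
  have := half_card S a c; rewrite supp_half -cF W3.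
  by move: #|F| #|half _ _ _|; clear; lia.
split=> //; first by rewrite Fc -cF.
move=> t tF; set A1 := half a (c + 1) A.
have keyF b d : splits b A -> (2 * #|half b d S| < 3 * #|F|)%N -> #|half b d S| = #|F|.
  rewrite -W3 => sb /(key _ _ sb) E; apply/eqP.
  rewrite -(eqn_pmul2l (expn_gt0 2 r.+1 : (0 < 2 ^ r.+1)%N)) -E cF -Fc.
  by rewrite -(eqn_pmul2l (isT : 0 < 2)%N) !card_half.
have BA1 : translate t F \subset A1.
  by apply/subsetP=> x; rewrite mem_translate => /tF; rewrite pt_addK.
have [p pF] : exists p, p \in F by apply/card_gt0P.
have ptA1 := tF p pF.
have E : #|supp f A1 :&: translate t F| = #|supp (fun x => f (x + t)) F|.
  rewrite -(card_translate t (supp _ F)) -supp_flat_translate; apply: eq_card => x.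
  rewrite in_setI !in_supp; case: (boolP (x \in translate t F)) => [xT|]; rewrite ?andbF //.
  by rewrite (subsetP BA1 _ xT) andbT.
have := @balanced_flat _ (supp f A1) A1 (translate t F).
rewrite flat_half // flat_translate // BA1 supp_sub E S1 card_translate.
have -> : #|A1| = (2 ^ r.+1 * #|F|)%N.
  by rewrite cF -Fc; apply/eqP; rewrite -(eqn_pmul2l (isT : 0 < 2)%N) !card_half.
move=> bal; apply/eqP; rewrite -(eqn_pmul2r F1) -bal //.
- by rewrite (mulnC #|supp _ _|) mulnAC.
- by apply/set0Pn; exists (p + t); rewrite mem_translate pt_addK.
(* [b] vanishes on the translate of [F]; correcting its constant makes [b'] vanish on [F], as
   [quarters] needs. *)
move=> b b0 sb; pose b' := b + (0, aev b 0 + aev b t).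
have b'0 x : x \in half a c S -> aev b' x = 0.
  rewrite -supp_half -/F => xF; have : x + t \in translate t F by rewrite mem_translate pt_addK.
  move/b0; rewrite -[x + t](addr0 _) aev_addpt aevD aev_const.
  by rewrite -addrA (addrC (aev b t)).
have sb1 : splits b' A1 by rewrite splits_const.
have sb' := splits_sub fA (half_sub _ _ _) sb1.
have sab : splits (a + b') A.
  apply: (splits_sub fA (half_sub a (c + 1) A)).
  case/andP: sb1 => /set0Pn[x] + /set0Pn[y].
  rewrite !in_half => /andP[/andP[xA /eqP xc] /eqP x0] /andP[/andP[yA /eqP yc] /eqP y1].
  apply: (@splitsI _ _ _ x y); rewrite ?in_half ?xA ?yA ?xc ?yc ?eqxx //.
  by rewrite !(aevD a) xc yc x0 y1; case: (F2P c) => ->.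
(* The two parts of the heavy half are themselves halves of the whole support, under [b'] and
   [a + b']. They sum to [2 * #|F|], so one is below 3/2 of [#|F|]; it then equals [#|F|], and so
   does the other. *)
have [_ q2 _ q4] := quarters b'0.
have bal' : #|half b' 0 (supp f A1)| = #|half b' 1 (supp f A1)|.
  have := keyF _ 1 sb'; have := keyF _ (c + 1) sab; rewrite q2 q4 -(supp_half f a) -/A1.
  have := half_card (supp f A1) b' 0; rewrite S1 add0r.
  by move: F1; move: #|half b' 0 _| #|half b' 1 _| #|F|; clear; lia.
move: bal'; rewrite !half_const.
by case: (F2P (aev b 0 + aev b t)) => ->; rewrite !(add0r, addr0, F2_addxx).
Qed.

End Core.


(** * From degree three on: a hyperplane missing the support *)

Section Structure.
Variable m : nat.
Implicit Types (x y z v : pt m) (A B S F : {set pt m}) (a b : form m) (c d : 'F_2).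
Implicit Types (f g : pt m -> 'F_2) (n r : nat).

Lemma card_supp_addlt f g F z : z \in F -> f z != 0 -> g z != 0 ->
  (#|supp (fun x => (f x + g x)%R) F| < #|supp f F| + #|supp g F|)%N.
Proof.
move=> zF fz gz; apply: leq_ltn_trans (_ : #|(supp f F :|: supp g F) :\ z| < _)%N.
  apply: subset_leq_card; apply/subsetP=> x; rewrite in_setD1 in_setU !in_supp.
  case/andP=> xF; rewrite xF /=.
  case: (eqVneq x z) => [->|_]; first by move: fz gz; rewrite !F2_neq0 => /eqP-> /eqP->.
  by case: (eqVneq (f x) 0) => [->|] //; rewrite add0r.
have := cardsD1 z (supp f F :|: supp g F); rewrite in_setU !in_supp zF fz /= add1n.
by move=> <-; apply: leq_card_setU.
Qed.

Lemma card_supp_add f g F :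
  (#|supp (fun x => (f x + g x)%R) F| <= #|supp f F| + #|supp g F|)%N.
Proof.
apply: leq_trans (leq_card_setU _ _).
apply: subset_leq_card; apply/subsetP=> x; rewrite in_setU !in_supp.
case/andP=> xF; rewrite xF /=.
by case: (eqVneq (f x) 0) => [->|] //; rewrite add0r.
Qed.

(* Otherwise, with [F] the support in the lighter half of [a], the translates of [F] on which [f]
   agrees force [f] to be invariant under some direction [k] on the heavier half, and then
   [deriv k f] is too light for its degree. *)
Theorem zero_half k f A : flat A -> deg_lt k.+4 f A -> A != set0 ->
    (2 * (2 ^ k.+3 * #|supp f A|) = 3 * #|A|)%N ->
  exists b d, splits b A /\ supp f (half b d A) = set0.
Proof.
move=> fA df A0 W.
case: (boolP [exists b, exists d, splits b A && (supp f (half b d A) == set0)]).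
  by case/existsP=> b /existsP[d /andP[sb /eqP s0]]; exists b, d.
rewrite negb_exists => /forallP /= ne.
have {}ne b d : splits b A -> supp f (half b d A) != set0.
  by move=> sb; move: (ne b); rewrite negb_exists => /forallP/(_ d); rewrite sb.
have [a [c [sa fF cA0 cS1 coset]]] := minimal_half fA df A0 W ne.
set F := supp f _ in fF cA0 cS1 coset; set A1 := half a (c + 1) A in cS1 coset.
have F0 : F != set0 by apply: ne.
have F1 : (0 < #|F|)%N by rewrite card_gt0.
have FA x : x \in F -> x \in A by rewrite in_supp in_half => /andP[/andP[]].
have Fc x : x \in F -> aev a x = c by rewrite in_supp in_half => /andP[/andP[_ /eqP]].
have F1f x : x \in F -> f x = 1 by rewrite in_supp F2_neq0 => /andP[_ /eqP].
have f0 x : x \in A -> aev a x = c -> x \notin F -> f x = 0.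
  by rewrite in_supp in_half => -> -> /=; rewrite eqxx negbK => /eqP.
have A1A x : x \in A1 -> x \in A by rewrite in_half => /andP[].
have A1c x : x \in A1 -> aev a x = c + 1 by rewrite in_half => /andP[_ /eqP].
case/set0Pn: (F0) => z zF; have zA := FA _ zF.
have dirA p q : p \in A1 -> q \in A -> q + (z + p) \in A.
  by move=> pA1; apply: flat_dir => //; apply: A1A.
have dira p q : p \in A1 -> aev a (q + (z + p)) = aev a q + 1.
  by move=> pA1; rewrite addrA aev_addpt (Fc z) // (A1c p) // addrA -(addrA _ c c) F2_addxx addr0.
have FsA1 p : p \in A1 -> forall q, q \in F -> q + (z + p) \in A1.
  by move=> pA1 q qF; rewrite in_half dirA ?FA //= dira // Fc.
have wF p : p \in A1 -> (2 ^ k.+3 * #|supp (fun q => f (q + (z + p))%R) F| = 2 * #|F|)%N.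
  by move=> pA1; apply/coset/FsA1.
have FsubA : F \subset A by apply/subsetP.
have [x [xS xA1]] : exists x, f x = 1 /\ x \in A1.
  have : (0 < #|supp f A1|)%N by rewrite cS1; move: F1; clear; lia.
  by case/card_gt0P=> x; rewrite in_supp F2_neq0 => /andP[xA1 /eqP fx]; exists x.
(* The heavier half carries [2 * #|F|] support points, so they do not all lie in the translate of
   [F] through [x]. *)
have [y [yS yA1 xyF]] : exists y, [/\ f y = 1, y \in A1 & y + (z + x) \notin F].
  have : ~~ (supp f A1 \subset translate (z + x) F).
    apply/negP=> /subset_leq_card; rewrite card_translate cS1; move: F1; clear; lia.
  case/subsetPn=> y; rewrite in_supp mem_translate F2_neq0 => /andP[yA1 /eqP fy] yF.
  by exists y.
(* [s] and [t] move [z] to [x] and to [y]; their sum [kk] preserves both halves and will be the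
   direction of invariance. *)
pose s := z + x; pose t := z + y; pose kk := x + y.
have stk : s + t = kk by rewrite /s /t pt_addxyx.
have dFk q : q \in F -> q + kk \notin F.
  move=> qF; apply: contra xyF => qkF.
  have := flat_dir fF qF qkF zF; rewrite pt_addKl /kk.
  by rewrite addrA addrC.
have kkA q : q \in A -> q + kk \in A by apply: flat_dir => //; apply: A1A.
have kka q : aev a (q + kk) = aev a q.
  by rewrite /kk addrA aev_addpt (A1c x) // (A1c y) // -addrA F2_addxx addr0.
have fk0 q : q \in F -> f (q + kk) = 0.
  by move=> qF; apply: f0; rewrite ?kkA ?FA ?kka ?Fc ?dFk.
have dst : deg_lt k.+2 (deriv t (deriv s f)) A by apply: df => q qA; apply: dirA.
(* On [F] the second derivative along [s] and [t] is [1 + f (q + s) + f (q + t)]. So [g] has degree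
   below [k.+2], while its weight is below the minimum because both its terms are 1 at [z]. *)
have Qst q : q \in F -> f (q + s) = f (q + t).
  move=> qF; pose g q := f (q + s) + f (q + t).
  suff /eqP g0 : supp g F == set0.
    have : q \notin supp g F by rewrite g0 inE.
    rewrite in_supp qF negbK /g; case: (F2P (f (q + s))) => ->; case: (F2P (f (q + t))) => -> //.
  apply/negPn/negP=> gn0.
  have dg : deg_lt k.+2 g F.
    have := deg_ltD (deg_lt_sub fA FsubA dst) (@deg_lt_const _ k.+1 1 F).
    apply: deg_lt_ext => q' qF'; rewrite /deriv F1f // -(addrA q') (addrC t s) stk fk0 //.
    by rewrite /g; case: (F2P (f (q' + s))) (F2P (f (q' + t))) => -> [] ->; apply/eqP.
  have := min_weight fF dg gn0.
  have := @card_supp_addlt (fun q => f (q + s)) (fun q => f (q + t)) F z zF.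
  rewrite /s /t !pt_addKl xS yS => /(_ isT isT).
  have := wF x xA1; have := wF y yA1; rewrite -/s -/t.
  rewrite (expnS 2 k.+2) expnS.
  have := expn_gt0 2 k.+1.
  move: (2 ^ k.+1)%N #|supp g F| #|supp (fun _ => _) F| #|supp (fun _ => _) F| F1.
  by move: #|F|; clear => F u w1 w2 w3; nia.
(* For [p] in neither translate, the third derivative, along [s'] too, reduces on [F] by [Qst] to
   [1 + f (q + s') + f (q + s' + kk)]. So [g] has degree below [k.+1], but at most half of the
   minimum weight for it. *)
have inv p : p \in A1 -> f p = f (p + kk).
  move=> pA1; pose s' := z + p.
  have ps' : p = z + s' by rewrite /s' pt_addKl.
  case: (boolP (p + s \in F)) => psF.
    by rewrite -stk addrA -(Qst _ psF) pt_addK.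
  case: (boolP (p + t \in F)) => ptF.
    by rewrite -stk (addrC s) addrA (Qst _ ptF) pt_addK.
  have ns q w : q \in F -> w \in A1 -> p + (z + w) \notin F -> f (q + (z + w) + s') = 0.
    move=> qF wA1 pwF; apply: f0.
    - by apply/dirA/dirA/FA.
    - by rewrite !dira // Fc // -addrA F2_addxx addr0.
    apply: contra pwF => h; have := flat_dir fF qF h zF.
    by rewrite -[q + _ + _]addrA pt_addKl /s' [z + w + _]addrC addrA pt_addKl.
  pose g q := f (q + s') + f (q + s' + kk).
  suff /eqP g0 : supp g F == set0.
    have : z \notin supp g F by rewrite g0 inE.
    rewrite in_supp zF negbK /g -ps'.
    by case: (F2P (f p)) => ->; case: (F2P (f (p + kk))) => -> //.
  apply/negPn/negP=> gn0.
  have dg : deg_lt k.+1 g F.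
    have d3 : deg_lt k.+1 (deriv s' (deriv t (deriv s f))) A by apply: dst => q qA; apply: dirA.
    have := deg_ltD (deg_lt_sub fA FsubA d3) (@deg_lt_const _ k 1 F).
    apply: deg_lt_ext => q qF; rewrite /deriv /g F1f // Qst // (addrAC q s' s) (addrAC q s' t).
    have kE w : w + t + s = w + kk by rewrite -addrA (addrC t) stk.
    rewrite (ns q x) // (ns q y) // (addrAC q t s') !kE fk0 //.
    by case: (F2P (f (q + t))) (F2P (f (q + s'))) (F2P (f (q + s' + kk))) => -> [] -> [] ->; apply/eqP.
  have := min_weight fF dg gn0.
  have := @card_supp_add (fun q => f (q + s')) (fun q => f (q + s' + kk)) F.
  have pkA1 : p + kk \in A1 by rewrite in_half kkA ?A1A //= kka A1c.
  have := wF p pA1.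
  have : (2 ^ k.+3 * #|supp (fun q => (f (q + s' + kk))%R) F| = 2 * #|F|)%N.
    rewrite -(wF _ pkA1); congr (_ * _)%N; apply: eq_card => q.
    by rewrite !in_supp -(addrA q) -(addrA z).
  rewrite (expnS 2 k.+2) !expnS.
  have := expn_gt0 2 k.
  move: (2 ^ k)%N #|supp g F| #|supp (fun _ => _) F| #|supp (fun _ => _) F| F1.
  by move: #|F|; clear => F u w1 w2 w3; nia.
(* As [deriv kk f] vanishes on the heavier half, its degree bound drops once more on the lighter
   one. There it is nonzero at [z], but its at most [2 * #|F|] support points are too few. *)
have sd1 : supp (deriv kk f) A1 = set0.
  apply/setP=> q; rewrite in_supp in_set0; apply/negP=> /andP[qA1].
  by rewrite /deriv -inv // F2_addxx eqxx.
have dk : deg_lt k.+3 (deriv kk f) A := df kk kkA.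
have := deg_lt_half0 fA sa dk sd1.
rewrite -addrA F2_addxx addr0 => dk0.
have nz : supp (deriv kk f) (half a c A) != set0.
  apply/set0Pn; exists z; rewrite in_supp in_half zA Fc //= eqxx /deriv F1f // fk0 //.
have := min_weight (flat_half _ _ fA) dk0 nz; rewrite cA0.
have : (#|supp (deriv kk f) (half a c A)| <= 2 * #|F|)%N.
  apply: leq_trans (card_supp_add _ _ _) _; rewrite mul2n -addnn leq_add2l -(card_translate kk F).
  apply: subset_leq_card; apply/subsetP=> q; rewrite mem_translate !in_supp !in_half.
  by move=> /andP[/andP[qA qc] ->]; rewrite kkA // kka qc.
rewrite !expnS.
have := expn_gt0 2 k.
move: (2 ^ k)%N #|supp _ _| F1.
by move: #|F|; clear; nia.
Qed.

End Structure.


(** * Reduction to degree two and the quadratic normal form *)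

Section Quadratic.
Variable m : nat.
Implicit Types (x y z v : pt m) (A B S F : {set pt m}) (a b : form m) (c d : 'F_2).
Implicit Types (f g : pt m -> 'F_2) (n r : nat).

(** Each application of [zero_half] halves the flat, keeps the support and lowers the degree bound
    by one, so the weight stays 3/2 of the minimum. *)
Lemma reduce_degree k f A : flat A -> deg_lt k.+3 f A -> A != set0 ->
    (2 * (2 ^ k.+2 * #|supp f A|) = 3 * #|A|)%N ->
  exists B, [/\ flat B, #|A| = (2 ^ k * #|B|)%N, supp f A = supp f B,
    deg_lt 3 f B & B != set0].
Proof.
elim: k A => [|k IH] A fA df A0 W.
  by exists A; split; rewrite ?mul1n.
have [b [d [sb s0]]] := zero_half fA df A0 W.
have d1 := deg_lt_half0 fA sb df s0.
have E : supp f A = supp f (half b (d + 1) A).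
  apply/setP=> x; rewrite !in_supp in_half.
  case: (eqVneq (aev b x) (d + 1)); rewrite ?andbT // andbF /=.
  move=> bx; case: (boolP (x \in A)) => //= xA; case: (eqVneq (f x) 0) => //= fx.
  have : x \in supp f (half b d A).
    rewrite in_supp in_half xA fx andbT /=; move: bx; rewrite F2_neq -addrA F2_addxx addr0.
    by move/eqP->.
  by rewrite s0 inE.
have cb := card_half (d + 1) fA sb.
have [||B [fB cB sB dB B0]] := IH _ (flat_half _ _ fA) d1.
- by apply/set0Pn; case/set0Pn: (splits_neq0 (d + 1) sb) => x; exists x.
- apply/eqP; rewrite -(eqn_pmul2l (isT : 0 < 2)%N) (mulnCA _ 3) cb -W -E.
  by rewrite (expnS _ k.+2) -!mulnA.
by exists B; split; rewrite // -?cb ?cB ?E // expnS mulnA.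
Qed.

(** Vanishing second derivatives make [f] preserve sums of three points, so its zero set is a flat;
    a form separating that flat from a point outside it agrees with [f]. *)
Lemma deg_lt2_form f A : flat A -> deg_lt 2 f A -> exists a, forall x, x \in A -> f x = aev a x.
Proof.
move=> fA df.
have fD x y z : x \in A -> y \in A -> z \in A -> f (x + y + z) = f x + f y + f z.
  move=> xA yA zA.
  have dir u : u \in A -> forall w, w \in A -> w + (x + u) \in A.
    by move=> uA w wA; apply: flat_dir.
  have := df _ (dir y yA) _ (dir z zA) x xA; rewrite /deriv pt_addKl pt_addKl.
  rewrite (addrC z).
  move=> /eqP h; apply/eqP; move: h.
  by case: (F2P (f x)) (F2P (f y)) (F2P (f z)) (F2P (f (x + y + z))) => -> [] -> [] -> [] ->.
pose Z := [set x in A | f x == 0].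
have ZA x : x \in Z -> x \in A by rewrite inE => /andP[].
have Z0 x : x \in Z -> f x = 0 by rewrite inE => /andP[_ /eqP].
have fZ : flat Z.
  apply/flatP=> x y z xZ yZ zZ; rewrite inE (flatP _ fA) ?ZA //= fD ?ZA //.
  by rewrite !Z0 // !addr0.
have notZ x : x \in A -> x \notin Z -> f x = 1.
  by move=> xA; rewrite inE xA /= F2_neq0 => /eqP.
have [Ze|[z zZ]] := set_0Vmem Z.
  by exists (0, 1) => x xA; rewrite aev_const notZ // Ze inE.
have [AZ|/subsetPn[u uA uZ]] := boolP (A \subset Z).
  by exists (0, 0) => x xA; rewrite aev_const Z0 // (subsetP AZ).
have [a [a0 a1]] := separation fZ uZ; exists a => x xA.
case: (boolP (x \in Z)) => xZ; first by rewrite a0 ?Z0.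
have : x + u + z \in Z.
  by rewrite inE (flatP _ fA) ?(ZA z) //= fD ?(ZA z) // (notZ x) // (notZ u) // (Z0 z).
move/a0; rewrite aev_addpt a1 (a0 z) // addr0 (notZ x) //.
by case: (F2P (aev a x)) => ->.
Qed.

(** The support is none, half or all of [A]; this divisibility later excludes weights such as 3/4 of
    a flat. *)
Lemma weight_form a A : flat A -> exists k, (2 * #|supp (aev a) A| = k * #|A|)%N.
Proof.
move=> fA; case: (boolP (splits a A)) => sa.
  exists 1%N; rewrite mul1n -(card_half 1 fA sa); congr (2 * _)%N.
  by apply: eq_card => x; rewrite in_supp in_half F2_neq0.
have [s0|[x xA]] := set_0Vmem (supp (aev a) A); first by exists 0%N; rewrite s0 cards0.
exists 2%N; congr (2 * _)%N; apply: eq_card => y; rewrite in_supp andb_idr // => yA.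
move: xA; rewrite in_supp => /andP[xA ax].
apply: contra sa => /eqP ay; apply: (splitsI xA yA); by rewrite ay.
Qed.

Lemma eq_supp f g A : (forall x, x \in A -> f x = g x) -> supp f A = supp g A.
Proof. by move=> fg; apply/setP=> x; rewrite !in_supp; case: (boolP (x \in A)) => //= /fg->. Qed.

Lemma weight_deg_lt2 f A : flat A -> deg_lt 2 f A -> exists k, (2 * #|supp f A| = k * #|A|)%N.
Proof.
move=> fA /(deg_lt2_form fA)[a fa]; rewrite (eq_supp fa); exact: weight_form.
Qed.

Lemma flat_inter4 F A : flat A -> flat F -> F \subset A -> F != set0 -> #|A| = (4 * #|F|)%N ->
  exists y1 y2 : form m, F = half y1 0 (half y2 0 A).
Proof.
move=> fA fF FA /set0Pn[p pF] cA.
have F1 : (0 < #|F|)%N by apply/card_gt0P; exists p.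
have /subsetPn[u uA uF] : ~~ (A \subset F).
  by apply/negP=> /subset_leq_card; rewrite cA; move: F1; clear; lia.
have [y2 [y20 y21]] := separation fF uF; have pA := subsetP FA _ pF.
have s2 : splits y2 A by apply: (splitsI pA uA); rewrite y20 ?y21.
have FA2 : F \subset half y2 0 A by apply/subsetP=> x xF; rewrite in_half (subsetP FA) // y20 /=.
have c2 : #|half y2 0 A| = (2 * #|F|)%N.
  by have := card_half 0 fA s2; rewrite cA; move: #|half _ _ _| #|F|; clear; lia.
have /subsetPn[w wA wF] : ~~ (half y2 0 A \subset F).
  by apply/negP=> /subset_leq_card; rewrite c2; move: F1; clear; lia.
have [y1 [y10 y11]] := separation fF wF; have pA2 := subsetP FA2 _ pF.
have s1 : splits y1 (half y2 0 A) by apply: (splitsI pA2 wA); rewrite y10 ?y11.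
exists y1, y2; apply/eqP; rewrite eqEcard; apply/andP; split.
  by apply/subsetP=> x xF; rewrite in_half (subsetP FA2) // y10 /=.
by rewrite -(leq_pmul2l (isT : 0 < 2)%N) (card_half _ (flat_half _ _ fA) s1) c2.
Qed.

(** On the lighter half the support is a flat of codimension two, so [f] is a product of two forms
    there. Removing that product leaves a function vanishing on the half, hence a multiple of its
    equation. *)
Lemma quadratic_form f A : flat A -> deg_lt 3 f A -> A != set0 ->
    (8 * #|supp f A| = 3 * #|A|)%N ->
  exists y1 y2 y3 y4 : form m, forall x, x \in A ->
    f x = aev y1 x * aev y2 x + aev y3 x * aev y4 x.
Proof.
move=> fA df A0 W.
(* Otherwise [f] would be affine on the other half with weight 3/4 of it. *)
have ne b d : splits b A -> supp f (half b d A) != set0.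
  move=> sb; apply/eqP=> s0; have d1 := deg_lt_half0 fA sb df s0.
  have [k E] := weight_deg_lt2 (flat_half _ _ fA) d1.
  have cs := card_supp_half f b d A; rewrite s0 cards0 add0n in cs; rewrite cs in E.
  have cb := card_half (d + 1) fA sb.
  have h1 : (0 < #|half b (d + 1)%R A|)%N by rewrite card_gt0 splits_neq0.
  move: W; rewrite -cb; move: E h1; move: #|half _ _ _| #|supp _ _|; clear => h s.
  by move=> E h1 W; have : (4 * k * h = 6 * h)%N; [lia|move/eqP; rewrite eqn_pmul2r // => /eqP; lia].
have W' : (2 * (2 ^ 2 * #|supp f A|) = 3 * #|A|)%N by rewrite mulnA.
have [a [c [sa fF cA0 _ _]]] := minimal_half fA df A0 W' ne.
set A0' := half a c A in fF cA0; set F := supp f A0' in fF cA0.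
have [y1 [y2 FE]] := flat_inter4 (flat_half a c fA) fF (supp_sub _ _) (ne _ _ sa) cA0.
(* [F] is where [y1] and [y2] both vanish, so its indicator is the product of the complemented
   forms. *)
pose z1 := y1 + (0, 1); pose z2 := y2 + (0, 1).
pose g x := f x + aev z1 x * aev z2 x.
have g0 x : x \in A -> aev a x = c -> g x = 0.
  move=> xA xc; have xA0 : x \in A0' by rewrite in_half xA xc /=.
  have : (x \in F) = (f x != 0) by rewrite in_supp xA0.
  rewrite FE !in_half xA xc eqxx /= /g !aevD !aev_const.
  move=> h; apply/eqP; move: h.
  by case: (F2P (f x)) (F2P (aev y1 x)) (F2P (aev y2 x)) => -> [] -> [] ->.
have dg : deg_lt 3 g A.
  apply: deg_ltD df _; have := deg_lt_mulform z1 (@deg_lt_form _ z2 A); exact.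
have /set0Pn[p] := splits_neq0 c sa; have /set0Pn[q] := splits_neq0 (c + 1) sa.
rewrite !in_half => /andP[qA /eqP qc] /andP[pA /eqP pc].
have dirA x : x \in A -> x + (p + q) \in A by apply: flat_dir.
(* The cofactor [l] is the derivative of [g] along a direction crossing the halves; it agrees with
   [g] where [a] is [c + 1]. *)
have [l lE] := deg_lt2_form fA (dg _ dirA : deg_lt 2 _ A).
exists z1, z2, (a + (0, c)), l => x xA; rewrite -lE // aevD aev_const /deriv.
have aq : aev a (x + (p + q)) = aev a x + 1.
  by rewrite addrA aev_addpt pc qc -addrA (addrA c) F2_addxx add0r.
suff -> : f x = g x + aev z1 x * aev z2 x.
  rewrite addrC; congr (_ + _); case: (eqVneq (aev a x) c) => [xc|].
    by rewrite g0 // xc F2_addxx mul0r.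
  rewrite F2_neq => /eqP xc; rewrite (g0 (x + _)) ?dirA // ?aq xc -?addrA ?F2_addxx ?addr0 //.
  by rewrite addrC -addrA F2_addxx addr0 mul1r.
by rewrite /g -addrA F2_addxx addr0.
Qed.

Theorem weight_three_halves r f : deg_lt r.+1 f [set: pt m] ->
    (2 * (2 ^ r * #|supp f [set: pt m]|) = 3 * 2 ^ m)%N ->
  (2 <= r)%N /\ exists A, exists y1 y2 y3 y4 : form m,
    [/\ flat A, (2 ^ r * #|A| = 4 * 2 ^ m)%N, (8 * #|supp f A| = 3 * #|A|)%N,
      (forall x, x \notin A -> f x = 0) &
      forall x, x \in A -> f x = aev y1 x * aev y2 x + aev y3 x * aev y4 x].
Proof.
have cT : #|[set: pt m]| = (2 ^ m)%N by rewrite cardsT card_ffun card_ord card_ord.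
rewrite -cT => df W.
have T0 : (0 < #|[set: pt m]|)%N by rewrite cT expn_gt0.
(* For [r] equal to 0 the weight would exceed the whole space; for [r] equal to 1 it would not be a
   multiple of half of it. *)
case: r df W => [|[|k]] df W.
- have [k E] := weight_deg_lt2 (flatT m) (deg_ltS df).
  have : (#|supp f [set: pt m]| <= #|[set: pt m]|)%N by apply/subset_leq_card/subsetT.
  by move: W T0; move: #|supp _ _| #|[set: pt m]|; clear; lia.
- have [k E] := weight_deg_lt2 (flatT m) df.
  move: W T0; rewrite mulnCA expn1 E; move: #|[set: pt m]| {E} => t W t0.
  by move/eqP: W; rewrite mulnA eqn_pmul2r //; move/eqP; clear; lia.
have [|B [fB cB sB dB B0]] := reduce_degree (flatT m) df _ W.
  by rewrite -card_gt0.
have WB : (8 * #|supp f B| = 3 * #|B|)%N.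
  apply/eqP; rewrite -(eqn_pmul2l (expn_gt0 2 k : (0 < 2 ^ k)%N)) (mulnCA _ 3) -cB -W -sB.
  by apply/eqP; rewrite !expnS; move: (2 ^ k)%N #|supp _ _|; clear; lia.
have [y1 [y2 [y3 [y4 yE]]]] := quadratic_form fB dB B0 WB.
split=> //; exists B, y1, y2, y3, y4; split=> //.
  by rewrite cB !expnS; move: (2 ^ k)%N #|B|; clear; lia.
move=> x xB; apply/eqP; apply: contraT => fx.
have : x \in supp f [set: pt m] by rewrite in_supp inE.
by rewrite sB in_supp (negbTE xB).
Qed.

End Quadratic.


(** * Elimination *)

Section Echelon.
Variable m : nat.
Implicit Types (x y z v : pt m) (A B S F : {set pt m}) (a b : form m) (c d : 'F_2).
Implicit Types (f g : pt m -> 'F_2) (n r : nat) (i j : 'I_m) (h : {set 'I_m}).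

(* [lead a] is one more than the largest index of a variable of [a], and [0] if [a] is constant. *)
Definition lead a : nat := (\max_(i | a.1 i != 0%R) i.+1)%N.

Lemma lead_leP a n : reflect (forall i, (n <= i)%N -> a.1 i = 0) (lead a <= n)%N.
Proof.
apply: (iffP (bigmax_leqP _ _ _)) => H i.
  by move=> ni; apply/eqP; apply: contraT => /H; rewrite ltnNge ni.
by move=> ai; rewrite ltnNge; apply: contra ai => /H->.
Qed.

Lemma lead_coef a i : lead a = i.+1 -> a.1 i = 1.
Proof.
move=> la; apply/eqP; rewrite -F2_neq0; apply: contraT; rewrite negbK => /eqP ai.
suff : (lead a <= i)%N by rewrite la ltnn.
apply/lead_leP=> j; rewrite leq_eqVlt => /orP[/eqP/val_inj<-//|ij].
by move: (leqnn (lead a)) => /lead_leP; apply; rewrite la.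
Qed.

Lemma lead_coef0 a i j : lead a = i.+1 -> (i < j)%N -> a.1 j = 0.
Proof. by move=> la ij; apply: (lead_leP a i.+1 _); rewrite ?la. Qed.

Lemma lead_gt0P a : (0 < lead a)%N -> exists i, lead a = i.+1.
Proof.
move=> l0; have lm : ((lead a).-1 < m)%N.
  by rewrite prednK //; apply/bigmax_leqP=> i _; apply: ltn_ord.
by exists (Ordinal lm); rewrite /= prednK.
Qed.

Lemma lead0_const a x : lead a = 0%N -> aev a x = a.2.
Proof.
move=> l0; rewrite aevE big1 ?add0r // => i _.
by rewrite (lead_leP a 0%N _) ?mul0r ?l0.
Qed.

Lemma leadD_le a b n : (lead a <= n)%N -> (lead b <= n)%N -> (lead (a + b)%R <= n)%N.
Proof.
move=> /lead_leP an /lead_leP bn; apply/lead_leP=> i ni.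
by rewrite ffunE an ?bn ?addr0.
Qed.

Lemma leadD_lt a b : (0 < lead a)%N -> lead a = lead b -> (lead (a + b)%R < lead a)%N.
Proof.
move=> /lead_gt0P[i ai] ab; have bi : lead b = i.+1 by rewrite -ab.
rewrite ai ltnS; apply/lead_leP=> j; rewrite leq_eqVlt ffunE => /orP[/eqP/val_inj<-|ij].
  by rewrite !lead_coef // F2_addxx.
by rewrite (lead_coef0 ai) ?(lead_coef0 bi) ?addr0.
Qed.

Lemma lead_const a c : lead (a + (0, c)) = lead a.
Proof. by apply: eq_bigl => i; rewrite !ffunE addr0. Qed.

Definition vanish a A : bool := [forall x in A, aev a x == 0].

Lemma vanishP a A : reflect (forall x, x \in A -> aev a x = 0) (vanish a A).
Proof. by apply: (iffP forall_inP) => H x /H => [/eqP|->]. Qed.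

Lemma vanishD a b A : vanish a A -> vanish b A -> vanish (a + b) A.
Proof. by move=> /vanishP aA /vanishP bA; apply/vanishP=> x xA; rewrite aevD aA ?bA ?addr0. Qed.

Lemma vanish0 A : vanish 0 A.
Proof. by apply/vanishP=> x _; rewrite (aev_const 0 x). Qed.

(** The leading positions of an echelon form of the equations of [A], defined without choosing
    one. *)
Definition pivots A : {set 'I_m} := [set i : 'I_m | [exists a : form m, vanish a A && (lead a == i.+1)]].

Lemma pivotsP A i : reflect (exists2 a, vanish a A & lead a = i.+1) (i \in pivots A).
Proof.
rewrite inE; apply: (iffP existsP) => [[a /andP[aA /eqP la]]|[a aA la]]; exists a => //.
by rewrite aA la eqxx.
Qed.

(** Elimination from the largest index downwards: a pivot variable is cleared by adding an equation
    of [A], which otherwise affects only smaller variables. *)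
Lemma reduce_pivots A n a : exists b, [/\ vanish b A, (lead b <= n)%N &
  forall j, j \in pivots A -> (j < n)%N -> (a + b).1 j = 0].
Proof.
elim: n a => [|n IH] a.
  by exists 0; split=> //; [exact: vanish0 | apply/lead_leP=> i _; rewrite ffunE].
case: (boolP [exists j : 'I_m, [&& val j == n, j \in pivots A & a.1 j != 0]]).
  case/existsP=> i /and3P[/eqP ni /pivotsP[e eA le] ai].
  have [b [bA lb bj]] := IH (a + e); exists (e + b); split.
  - exact: vanishD.
  - by apply: leadD_le; [rewrite le -ni | apply: leqW].
  move=> j jh; rewrite ltnS leq_eqVlt addrA => /orP[/eqP jn|]; last exact: bj.
  have -> : j = i by apply: val_inj; rewrite /= jn -ni.
  rewrite 2!ffunE (lead_coef le); move: ai; rewrite F2_neq0 => /eqP->.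
  by rewrite (lead_leP b n lb i) ?ni // F2_addxx addr0.
rewrite negb_exists => /forallP none.
have [b [bA lb bj]] := IH a; exists b; split=> //; first exact: leqW.
move=> j jh; rewrite ltnS leq_eqVlt => /orP[/eqP jn|]; last exact: bj.
have := none j; rewrite jh /= jn eqxx /= negbK => /eqP aj.
by rewrite ffunE aj (lead_leP b n lb j) ?jn // addr0.
Qed.

Lemma reduced_pivot A i : i \in pivots A ->
  exists a, [/\ vanish a A, lead a = i.+1 &
    forall j, j \in pivots A -> j != i -> a.1 j = 0].
Proof.
case/pivotsP=> e eA le; have [b [bA lb bj]] := reduce_pivots A i e.
have ei : (e + b).1 i = 1 by rewrite ffunE (lead_coef le) (lead_leP b i lb) ?addr0.
have la : lead (e + b) = i.+1.
  apply/eqP; rewrite eqn_leq leadD_le ?le ?(leqW lb) //= ltnNge.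
  by apply/lead_leP=> /(_ i (leqnn _)); rewrite ei => /eqP.
exists (e + b); split=> //; first exact: vanishD.
move=> j jh ji; case: (ltngtP j i) => [|ij|/val_inj/eqP]; first exact: bj.
- exact: lead_coef0 la ij.
- by rewrite (negbTE ji).
Qed.

(** By induction on the lead, every equation of [A] follows from the [e i]; and by [separation] a
    point outside [A] violates some equation. *)
Lemma flat_pivots A (e : 'I_m -> form m) : flat A -> A != set0 ->
  (forall i, i \in pivots A -> vanish (e i) A /\ lead (e i) = i.+1) ->
  forall x, (x \in A) = [forall i in pivots A, aev (e i) x == 0].
Proof.
move=> fA /set0Pn[p pA] eP x; apply/idP/forall_inP => [xA i /eP[/vanishP eA _]|ex].
  by rewrite eA.
have van n b : vanish b A -> (lead b <= n)%N -> aev b x = 0.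
  elim: n b => [|n IH] b bA.
    rewrite leqn0 => /eqP lb; rewrite lead0_const // -(lead0_const p lb).
    exact: (vanishP _ _ bA).
  rewrite leq_eqVlt => /orP[/eqP lb|]; last exact: IH.
  have [|i bi] := @lead_gt0P b; first by rewrite lb.
  have ih : i \in pivots A by apply/pivotsP; exists b.
  have [eA le] := eP i ih.
  have lbe : (lead (b + e i)%R <= n)%N by rewrite -ltnS -lb leadD_lt ?bi ?le.
  by have := IH _ (vanishD bA eA) lbe; rewrite aevD (eqP (ex i ih)) addr0.
case: (boolP (x \in A)) => // xA; have [b [b0 b1]] := separation fA xA.
by have := van _ b (introT (vanishP _ _) b0) (leqnn _); rewrite b1 => /eqP.
Qed.

(** * Sums of two products with distinct leading variables *)

Section Symplectic.
Variables (f : pt m -> 'F_2) (A : {set pt m}) (h : {set 'I_m}).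
Hypothesis fA : flat A.
Hypothesis A0 : A != set0.
Hypothesis W : (8 * #|supp f A| = 3 * #|A|)%N.

Definition avoids a : bool := [forall i in h, a.1 i == 0].

Lemma avoidsP a : reflect (forall i, i \in h -> a.1 i = 0) (avoids a).
Proof. by apply: (iffP forall_inP) => H x /H => [/eqP|->]. Qed.

Lemma avoidsD a b : avoids a -> avoids b -> avoids (a + b).
Proof.
by move=> /avoidsP ah /avoidsP bh; apply/avoidsP=> i ih; rewrite ffunE ah ?bh ?addr0.
Qed.

Lemma avoids_const c : avoids (0, c).
Proof. by apply/avoidsP=> i _; rewrite ffunE. Qed.

Definition represents (y1 y2 y3 y4 : form m) : bool :=
  [&& avoids y1, avoids y2, avoids y3, avoids y4 &
   [forall x in A, f x == aev y1 x * aev y2 x + aev y3 x * aev y4 x]].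

Lemma representsP (y1 y2 y3 y4 : form m) : represents y1 y2 y3 y4 ->
  forall x, x \in A -> f x = aev y1 x * aev y2 x + aev y3 x * aev y4 x.
Proof. by case/and5P=> _ _ _ _ /forall_inP H x /H/eqP. Qed.

Lemma represents_swap12 (y1 y2 y3 y4 : form m) : represents y1 y2 y3 y4 -> represents y2 y1 y3 y4.
Proof.
case/and5P=> a1 a2 a3 a4 /forall_inP H; rewrite /represents a1 a2 a3 a4 /=.
by apply/forall_inP=> x /H; rewrite (mulrC (aev y1 x)).
Qed.

Lemma represents_swap (y1 y2 y3 y4 : form m) : represents y1 y2 y3 y4 -> represents y3 y4 y1 y2.
Proof.
case/and5P=> a1 a2 a3 a4 /forall_inP H; rewrite /represents a1 a2 a3 a4 /=.
by apply/forall_inP=> x /H; rewrite addrC.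
Qed.

(** The first product is unchanged because [(y2 + 1) * y2 = 0]. *)
Lemma represents_shear (y1 y2 y3 y4 : form m) :
  represents y1 y2 y3 y4 -> represents (y1 + y2 + (0, 1)) y2 y3 y4.
Proof.
case/and5P=> a1 a2 a3 a4 /forall_inP H.
rewrite /represents !avoidsD ?avoids_const // a2 a3 a4 /=.
apply/forall_inP=> x /H /eqP->; rewrite !aevD aev_const !mulrDl F2_mulxx mul1r.
by rewrite -(addrA (_ * _)) F2_addxx addr0.
Qed.

(** A symplectic transvection: the two new terms [y3 * y2] cancel. *)
Lemma represents_transvection (y1 y2 y3 y4 : form m) :
  represents y1 y2 y3 y4 -> represents (y1 + y3) y2 y3 (y4 + y2).
Proof.
case/and5P=> a1 a2 a3 a4 /forall_inP H.
rewrite /represents !avoidsD // a2 a3 /=.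
apply/forall_inP=> x /H /eqP->; rewrite !aevD mulrDl mulrDr.
by rewrite addrACA F2_addxx addr0.
Qed.

(** With [y1] constant, [f] would be affine on each half of [y3], or on [A]; its weight would be a
    multiple of a quarter of [#|A|], while it is 3/8 of it. *)
Lemma represents_lead_gt0 (y1 y2 y3 y4 : form m) : represents y1 y2 y3 y4 -> (0 < lead y1)%N.
Proof.
move=> R; rewrite lt0n; apply/eqP=> l0.
have fE x : x \in A -> f x = y1.2 * aev y2 x + aev y3 x * aev y4 x.
  by move/(representsP R); rewrite (lead0_const _ l0).
have Ap : (0 < #|A|)%N by rewrite card_gt0.
suff [k E] : exists k, (4 * #|supp f A| = k * #|A|)%N.
  have /eqP : (2 * k * #|A| = 3 * #|A|)%N by rewrite -W -mulnA -E mulnA.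
  by rewrite eqn_pmul2r // => /eqP; clear; lia.
have scale c (y : form m) : exists z : form m, forall x, c * aev y x = aev z x.
  case: (F2P c) => ->; first by exists (0, 0) => x; rewrite aev_const mul0r.
  by exists y => x; rewrite mul1r.
have [z zE] := scale y1.2 y2.
case: (boolP (splits y3 A)) => s3.
  have cs := card_supp_half f y3 0 A; have c0 := card_half 0 fA s3; have c1 := card_half 1 fA s3.
  have half_form c : exists w : form m, forall x, x \in half y3 c A -> f x = aev w x.
    have [w wE] := scale c y4; exists (z + w) => x; rewrite in_half => /andP[xA /eqP x3].
    by rewrite fE // aevD zE x3 wE.
  have hw c : exists k, (2 * #|supp f (half y3 c A)| = k * #|half y3 c A|)%N.
    have [w wE] := half_form c; rewrite (eq_supp wE).
    exact: weight_form (flat_half _ _ fA).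
  have [k0 E0] := hw 0; have [k1 E1] := hw 1; exists (k0 + k1)%N.
  by rewrite -cs add0r; lia.
have [p pA] := set0Pn _ A0.
have y3E x : x \in A -> aev y3 x = aev y3 p.
  by move=> xA; apply/eqP; apply: contraR s3 => ne; apply: (splitsI xA pA).
have [w wE] := scale (aev y3 p) y4.
have fzw x : x \in A -> f x = aev (z + w) x.
  by move=> xA; rewrite fE // aevD zE y3E // wE.
have [k E] := weight_form (z + w) fA; exists (2 * k)%N.
by rewrite (eq_supp fzw); lia.
Qed.

Definition lead_sum (y1 y2 y3 y4 : form m) : nat := (lead y1 + lead y2 + lead y3 + lead y4)%N.

Definition minimal (y1 y2 y3 y4 : form m) : Prop :=
  represents y1 y2 y3 y4 /\
  forall z1 z2 z3 z4 : form m, represents z1 z2 z3 z4 -> (lead_sum y1 y2 y3 y4 <= lead_sum z1 z2 z3 z4)%N.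

Lemma minimal_swap12 (y1 y2 y3 y4 : form m) : minimal y1 y2 y3 y4 -> minimal y2 y1 y3 y4.
Proof.
case=> R M; split=> [|z1 z2 z3 z4 /M]; first exact: represents_swap12.
by rewrite /lead_sum (addnC (lead y1)).
Qed.

Lemma minimal_swap (y1 y2 y3 y4 : form m) : minimal y1 y2 y3 y4 -> minimal y3 y4 y1 y2.
Proof.
case=> R M; split=> [|z1 z2 z3 z4 /M]; first exact: represents_swap.
by rewrite /lead_sum; clear; lia.
Qed.

(** Otherwise the shear would cancel the common leading variable and lower the sum of leads. *)
Lemma minimal_lead12 (y1 y2 y3 y4 : form m) : minimal y1 y2 y3 y4 -> lead y1 <> lead y2.
Proof.
case=> R M l12; have := M _ _ _ _ (represents_shear R).
have := leadD_lt (represents_lead_gt0 R) l12.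
by rewrite /lead_sum lead_const; clear; lia.
Qed.

(* Of the two transvections making [y1] and [y3] cancel, take the one that does not raise the
   lead of its other target. *)
Lemma minimal_lead13 (y1 y2 y3 y4 : form m) : minimal y1 y2 y3 y4 -> lead y1 <> lead y3.
Proof.
wlog le24 : y1 y2 y3 y4 / (lead y2 <= lead y4)%N.
  move=> H M; case/orP: (leq_total (lead y2) (lead y4)) => le; first exact: H le M.
  by move/esym; apply: H le (minimal_swap M).
case=> R M l13; have := M _ _ _ _ (represents_transvection R).
have := leadD_lt (represents_lead_gt0 R) l13.
have := leadD_le (leqnn (lead y4)) le24.
by rewrite /lead_sum; clear; lia.
Qed.

(** In a representation with least sum of leads, the symmetries of [y1 * y2 + y3 * y4] reduce all
    six inequalities to the pairs 1, 2 and 1, 3. *)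
Lemma distinct_leads (y1 y2 y3 y4 : form m) : represents y1 y2 y3 y4 ->
  exists z1 z2 z3 z4 : form m, exists s1 s2 s3 s4 : 'I_m,
    [/\ represents z1 z2 z3 z4, lead z1 = s1.+1, lead z2 = s2.+1 &
        [/\ lead z3 = s3.+1, lead z4 = s4.+1 & uniq [:: s1; s2; s3; s4]]].
Proof.
move=> R0.
pose Q (n : nat) := [exists y : form m * form m * form m * form m,
  represents y.1.1.1 y.1.1.2 y.1.2 y.2 && (lead_sum y.1.1.1 y.1.1.2 y.1.2 y.2 == n)].
have exQ : exists n, Q n.
  by exists (lead_sum y1 y2 y3 y4); apply/existsP; exists (y1, y2, y3, y4); rewrite R0 eqxx.
case: (ex_minnP exQ) => n /existsP[[[[z1 z2] z3] z4] /= /andP[R /eqP sE]] nmin.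
have M : minimal z1 z2 z3 z4.
  split=> // u1 u2 u3 u4 Ru; rewrite sE; apply: nmin; apply/existsP.
  by exists (u1, u2, u3, u4); rewrite Ru eqxx.
have Rs := represents_swap R.
have [s1 l1] := lead_gt0P (represents_lead_gt0 R).
have [s2 l2] := lead_gt0P (represents_lead_gt0 (represents_swap12 R)).
have [s3 l3] := lead_gt0P (represents_lead_gt0 Rs).
have [s4 l4] := lead_gt0P (represents_lead_gt0 (represents_swap12 Rs)).
exists z1, z2, z3, z4, s1, s2, s3, s4; split=> //; split=> //.
have M' := minimal_swap12 M.
have M34 := minimal_swap (minimal_swap12 (minimal_swap M)).
have M34' := minimal_swap12 M34.
have ne (i j : 'I_m) : i.+1 <> j.+1 -> (i == j) = false by move=> ij; apply/eqP=> e; apply: ij; rewrite e.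
rewrite /= !inE !ne //.
- by rewrite -l3 -l4; apply: minimal_lead12 (minimal_swap M).
- by rewrite -l2 -l4; apply: minimal_lead13 M34'.
- by rewrite -l2 -l3; apply: minimal_lead13 M'.
- by rewrite -l1 -l4; apply: minimal_lead13 M34.
- by rewrite -l1 -l3; apply: minimal_lead13 M.
- by rewrite -l1 -l2; apply: minimal_lead12 M.
Qed.

End Symplectic.

(* Since [aev y1 x * (aev y1 x + 1) = 0], adding [y1 + 1] to [y2] does not change the product. *)
Lemma reduce_pair h (y1 y2 : form m) (s1 s2 : 'I_m) : s1 != s2 -> avoids h y1 -> avoids h y2 ->
  lead y1 = s1.+1 -> lead y2 = s2.+1 ->
  exists z1 z2 : form m, [/\ avoids h z1 && avoids h z2, lead z1 = s1.+1, lead z2 = s2.+1,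
    z1.1 s2 = 0 /\ z2.1 s1 = 0 & forall x, aev z1 x * aev z2 x = aev y1 x * aev y2 x].
Proof.
wlog lt12 : y1 y2 s1 s2 / (s1 < s2)%N.
  move=> H ne a1 a2 l1 l2; case: (ltngtP s1 s2) => [lt|lt|/val_inj/eqP]; first exact: H lt ne a1 a2 l1 l2.
    rewrite eq_sym in ne; have [z2 [z1 [/andP[b2 b1] k2 k1 [c2 c1] E]]] := H _ _ _ _ lt ne a2 a1 l2 l1.
    by exists z1, z2; rewrite b1 b2; split=> // x; rewrite mulrC E mulrC.
  by rewrite (negbTE ne).
move=> ne a1 a2 l1 l2; have z12 := lead_coef0 l1 lt12.
case: (F2P (y2.1 s1)) => c2.
  by exists y1, y2; rewrite a1 a2; split.
exists y1, (y2 + y1 + (0, 1)); split=> //.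
- by rewrite a1 !avoidsD ?avoids_const.
- rewrite lead_const; apply/eqP; rewrite eqn_leq leadD_le ?l2 ?l1 ?(leqW lt12) //= ltnNge.
  apply/lead_leP=> /(_ s2 (leqnn _)); rewrite ffunE z12 (lead_coef l2) addr0 => /eqP //.
- by split=> //; rewrite !ffunE c2 (lead_coef l1) addr0 F2_addxx.
by move=> x; rewrite !aevD aev_const !mulrDr F2_mulxx mulr1 -addrA F2_addxx addr0.
Qed.

End Echelon.


Lemma F2_inj (x y : 'F_2) : (x != 0) = (y != 0) -> x = y.
Proof. by case: (F2P x) => ->; case: (F2P y) => ->. Qed.

(** * Monomials and the lower triangular affine group *)

(** Turns a comparison of k-th smallest indices into one of counts. *)
Lemma count_le_nth (s : seq nat) k v : sorted leq s -> (k < size s)%N ->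
  (nth 0 s k <= v)%N = (k < count (fun x => x <= v) s)%N.
Proof.
move=> ss ks; have mono := sorted_leq_nth leq_trans leqnn 0%N ss.
rewrite -{2}(cat_take_drop k s) count_cat.
have := mono; rewrite (drop_nth 0%N ks) /=.
case: (leqP (nth 0%N s k) v) => kv mon.
  rewrite (_ : count _ (take k s) = k) ?addnA ?addn1 ?addSn ?ltnS ?leq_addr //.
  rewrite -[RHS](size_takel (ltnW ks)); apply/eqP; rewrite -all_count.
  apply/(all_nthP 0%N) => i; rewrite size_takel ?(ltnW ks) // => ik.
  rewrite nth_take //; apply: leq_trans kv; apply: mon (ltnW ik) => //.
  by rewrite inE (ltn_trans ik).
rewrite add0n (_ : count _ (drop k.+1 s) = 0)%N.
  rewrite addn0; apply/esym/negbTE; rewrite -leqNgt.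
  by rewrite (leq_trans (count_size _ _)) // size_takel // ltnW.
apply/eqP; rewrite -leqn0 leqNgt -has_count; apply/hasPn=> x xs.
have [i ilt <-] := nthP 0%N xs; rewrite nth_drop -ltnNge (leq_trans kv) //.
rewrite size_drop ltn_subRL in ilt.
by apply: mon; rewrite ?inE // (leq_trans (leqnSn k)) ?leq_addr.
Qed.

Lemma sum_option (J : finType) (F : option J -> 'F_2) :
  \sum_o F o = F None + \sum_j F (Some j).
Proof.
rewrite (bigD1 None) //= (reindex_omap Some id) => [|[]//]; congr (_ + _).
by apply: eq_bigl => j; rewrite eqxx.
Qed.

Section Monomials.
Variable m : nat.
Implicit Types (x y z v : pt m) (f g k : mono m) (I : {set mono m}) (P Q : Rm m).

Lemma size_sidx f : size (sidx f) = #|f|.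
Proof. by rewrite size_sort size_map cardE. Qed.

Lemma sorted_sidx f : sorted leq (sidx f).
Proof. exact: sort_sorted leq_total _. Qed.

Lemma count_sidx f (v : nat) : count (fun j => j <= v)%N (sidx f) = #|[set i in f | (i <= v)%N]|.
Proof.
rewrite count_sort count_map cardE -size_filter /enum_mem -filter_predI; congr size.
by apply: eq_filter => i; rewrite !inE andbC.
Qed.

(** The image of [psi] is the intermediate monomial: as [psi] never lowers an index, the image has
    at most as many variables up to any bound as [g]. *)
Lemma mono_le_image f g (psi : 'I_m -> 'I_m) : {in g &, injective psi} ->
  (forall j, j \in g -> psi j \in f) -> (forall j, j \in g -> (j <= psi j)%N) -> mono_le g f.
Proof.
move=> psi_inj psif lepsi; apply/existsP; exists (psi @: g); apply/andP; split.
  by apply/subsetP=> _ /imsetP[j jg ->]; apply: psif.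
have cg : #|psi @: g| = #|g| by apply: card_in_imset.
rewrite /sh_le cg eqxx /=; apply/forallP=> k; apply/implyP=> kg.
rewrite count_le_nth ?sorted_sidx ?size_sidx // count_sidx.
set v := nth _ _ _; have : (nth 0%N (sidx (psi @: g)) k <= v)%N by [].
rewrite count_le_nth ?sorted_sidx ?size_sidx ?cg // count_sidx => /leq_trans; apply.
apply: leq_trans (leq_imset_card psi _); apply: subset_leq_card; apply/subsetP=> i.
rewrite inE => /andP[/imsetP[j jg ->] le]; apply: imset_f; rewrite inE jg.
exact: leq_trans (lepsi _ jg) le.
Qed.

Lemma in_code_sum I (J : finType) (F : J -> Rm m) : (forall j, in_code I (F j)) ->
  in_code I [ffun x => \sum_j F j x].
Proof.
move=> H; have [c cE] := fin_all_exists H; exists (fun f => \sum_j c j f) => x.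
rewrite ffunE (eq_bigr _ (fun j _ => cE j x)) exchange_big /=.
by apply: eq_bigr => f _; rewrite mulr_suml.
Qed.

Lemma in_code_scale I (c : 'F_2) P : in_code I P -> in_code I [ffun x => c * P x].
Proof.
case=> d dE; exists (fun f => c * d f) => x; rewrite ffunE dE mulr_sumr.
by apply: eq_bigr => f _; rewrite mulrA.
Qed.

Lemma in_code_mono I f : f \in I -> in_code I (mono_ev f).
Proof.
move=> fI; exists (fun g => (g == f)%:R) => x; rewrite (bigD1 f) //= eqxx mul1r.
by rewrite big1 ?addr0 // => g /andP[_ /negbTE->]; rewrite mul0r.
Qed.

Lemma in_code_zero I : in_code I [ffun=> 0].
Proof. by exists (fun=> 0) => x; rewrite ffunE big1 // => f _; rewrite mul0r. Qed.

(** Expanding the product of the substituted variables gives terms obtained from [f] by lowering,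
    dropping and merging variables, all of them below [f]. *)
Lemma mono_ev_lta b e I f : decreasing I -> f \in I -> in_code I (lta_act b e (mono_ev f)).
Proof.
move=> dI fI.
(* The choice [Some j] takes the variable [j] from factor [i], and [None] its constant; a factor
   with [i] outside [f] is the constant 1. *)
pose C (i : 'I_m) (o : option 'I_m) : 'F_2 :=
  if i \in f then if o is Some j then if j == i then 1 else if (j < i)%N then b i j else 0
     else e i
  else (o == None)%:R.
pose X x (o : option 'I_m) : 'F_2 := if o is Some j then x j else 1.
have -> : lta_act b e (mono_ev f) =
    [ffun x => \sum_(phi : {ffun 'I_m -> option 'I_m})
       [ffun x => (\prod_i C i (phi i)) * \prod_i X x (phi i)] x].
  apply/ffunP=> x; rewrite !ffunE.
  transitivity (\prod_i \sum_o C i o * X x o).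
    rewrite big_mkcond /=; apply: eq_bigr => i _; rewrite sum_option /= /C.
    case: (i \in f); last first.
      by rewrite /= mulr1 big1 ?addr0 // => j _; rewrite mul0r.
    rewrite ffunE mulr1 addrC; congr (_ + _).
    rewrite [RHS](bigD1 i) //= eqxx mul1r; congr (_ + _).
    rewrite big_mkcond [RHS]big_mkcond /=; apply: eq_bigr => j _.
    by case: (eqVneq j i) => [->|_] /=; rewrite ?ltnn //; case: ifP; rewrite ?mul0r.
  rewrite bigA_distr_bigA; apply: eq_bigr => phi _; rewrite ffunE.
  by rewrite big_split.
apply: in_code_sum => phi.
case: (eqVneq (\prod_i C i (phi i)) 0) => [->|/prodf_neq0 Cne].
  rewrite (_ : finfun _ = [ffun=> 0]); first exact: in_code_zero.
  by apply/ffunP=> x; rewrite !ffunE mul0r.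
have Cphi i j : phi i = Some j -> i \in f /\ (j <= i)%N.
  move=> ij; have := Cne i isT; rewrite ij /C; case: (i \in f) => //=.
  by case: (eqVneq j i) => [->|_]; [split | case: ltnP => [/ltnW|]; rewrite ?eqxx].
pose g : mono m := [set j | [exists i, phi i == Some j]].
have gI : g \in I.
  apply: dI fI _.
  (* [psi] picks for each variable of the term one factor that contributed it, so it is injective
     even when repeated variables were merged. *)
  have [psi psiE] : exists psi : 'I_m -> 'I_m, forall j, j \in g -> phi (psi j) = Some j.
    apply: (fin_all_exists (P := fun j i => j \in g -> phi i = Some j)) => j.
    case: (boolP (j \in g)) => [|_]; last by exists j.
    by rewrite inE => /existsP[i /eqP ij]; exists i.
  apply: (@mono_le_image f g psi).
  - by move=> j j' jg j'g E; apply: Some_inj; rewrite -(psiE j) // E psiE.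
  - by move=> j /psiE/Cphi[].
  - by move=> j /psiE/Cphi[].
have := in_code_scale (\prod_i C i (phi i)) (in_code_mono gI).
congr (in_code I _); apply/ffunP=> x; rewrite !ffunE; congr (_ * _); apply: F2_inj.
apply/prodf_neq0/prodf_neq0 => H i.
  move=> _; rewrite /X; case ij: (phi i) => [j|] //; apply: H.
  by rewrite inE; apply/existsP; exists i; rewrite ij.
by rewrite inE => /existsP[j /eqP ji]; have := H j isT; rewrite /X ji.
Qed.

Lemma in_code_lta b e I P : decreasing I -> in_code I P -> in_code I (lta_act b e P).
Proof.
move=> dI [c cE].
have -> : lta_act b e P = [ffun x => \sum_(f : mono m)
    (if f \in I then [ffun x => c f * lta_act b e (mono_ev f) x] else [ffun=> 0]) x].
  apply/ffunP=> x; rewrite !ffunE cE big_mkcond; apply: eq_bigr => f _.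
  by case: ifP; rewrite !ffunE.
apply: in_code_sum => f; case: ifP => fI; last exact: in_code_zero.
exact/in_code_scale/mono_ev_lta.
Qed.

Lemma lta_app_inj b e : injective (@lta_app m b e).
Proof.
move=> x y xy; apply/ffunP=> i; have [n] := ubnP (val i); elim: n i => // n IH i ltn.
have /ffunP/(_ i) := xy; rewrite !ffunE => /addIr.
rewrite (eq_bigr (fun j => b i j * y j)); first by move/addIr.
by move=> j ji; rewrite IH //; apply: leq_trans ji _; rewrite -ltnS.
Qed.

Lemma lta_act_inj b e : injective (@lta_act m b e).
Proof.
move=> P Q PQ; apply/ffunP=> x.
have [T' _ TK] := injF_bij (@lta_app_inj b e).
by have /ffunP/(_ (T' x)) := PQ; rewrite !ffunE TK.
Qed.

Definition codeb I P : bool :=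
  [exists c : {ffun mono m -> 'F_2}, [forall x, P x == \sum_(f in I) c f * mono_ev f x]].

Lemma codeP I P : reflect (in_code I P) (codeb I P).
Proof.
apply: (iffP existsP) => [[c /forallP cE]|[c cE]].
  by exists c => x; apply/eqP.
by exists (finfun c); apply/forallP=> x; rewrite cE; apply/eqP/eq_bigr => f _; congr (_ * _); rewrite ffunE.
Qed.

(** The action maps the finite code injectively into itself, hence onto itself, so no inverse matrix
    has to be computed. *)
Lemma in_code_lta_inv b e I P : decreasing I -> in_code I (lta_act b e P) -> in_code I P.
Proof.
move=> dI cP; pose X := [set Q | codeb I Q].
have XE : lta_act b e @: X = X.
  apply/eqP; rewrite eqEcard card_imset ?leqnn ?andbT; last exact: lta_act_inj.
  by apply/subsetP=> _ /imsetP[Q + ->]; rewrite !inE => /codeP cQ; apply/codeP/in_code_lta.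
have : lta_act b e P \in X by rewrite inE; apply/codeP.
by rewrite -XE => /imsetP[Q + /lta_act_inj->]; rewrite inE => /codeP.
Qed.

(** Evaluation at the indicator of [f] leaves only the divisors of [f]; the proper ones have
    coefficient 0 by induction on the degree. *)
Lemma mono_ev_indep (c : mono m -> 'F_2) :
  (forall x, \sum_f c f * mono_ev f x = 0) -> forall f, c f = 0.
Proof.
move=> H f; have [n] := ubnP #|f|; elim: n f => // n IH f ltn.
have := H [ffun i => (i \in f)%:R]; rewrite (bigD1 f) //= big1 ?addr0.
  suff -> : mono_ev f [ffun i => (i \in f)%:R] = 1 by rewrite mulr1.
  by rewrite ffunE big1 // => i fi; rewrite ffunE fi.
move=> g gf; case: (boolP (g \subset f)) => [sgf|/subsetPn[i ig iF]].
  rewrite IH ?mul0r //; rewrite ltnS in ltn; apply: leq_trans ltn; apply: proper_card.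
  by rewrite properEneq gf.
by rewrite ffunE (bigD1 i) //= ffunE (negbTE iF) mul0r mulr0.
Qed.

Lemma in_code_add_mono I f g : f != g -> in_code I (Rm_add (mono_ev f) (mono_ev g)) ->
  f \in I /\ g \in I.
Proof.
move=> fg [c cE].
have H := @mono_ev_indep (fun k => (k == f)%:R + (k == g)%:R + (if k \in I then c k else 0)).
have {}H k : (k == f)%:R + (k == g)%:R + (if k \in I then c k else 0) = 0.
  apply: H => x; have := cE x; rewrite ffunE big_mkcond /= => E.
  under eq_bigr do rewrite !mulrDl; rewrite !big_split /=.
  have pick p : \sum_(k : mono m) (k == p)%:R * mono_ev k x = mono_ev p x.
    rewrite (bigD1 p) //= eqxx mul1r big1 ?addr0 // => q /negbTE->; exact: mul0r.
  rewrite !pick E -[RHS](F2_addxx (\sum_(i : mono m) (if i \in I then c i * mono_ev i x else 0))).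
  congr (_ + _); by apply: eq_bigr => q _; case: ifP; rewrite ?mul0r.
split; [have := H f | have := H g]; rewrite eqxx 1?(negbTE fg) 1?(eq_sym g) ?(negbTE fg);
  by case: ifP.
Qed.

Lemma deg_lt_sum (J : Type) (s : seq J) (p : pred J) (F : J -> pt m -> 'F_2) n A :
  (forall j, p j -> deg_lt n (F j) A) -> deg_lt n (fun x => \sum_(j <- s | p j) F j x) A.
Proof.
move=> H; elim: s => [|j s IH].
  by apply: deg_lt0 => x _; rewrite big_nil.
have E x : \sum_(i <- j :: s | p i) F i x =
    (if p j then F j x else 0) + \sum_(i <- s | p i) F i x.
  by rewrite big_cons; case: ifP; rewrite ?add0r.
apply: deg_lt_ext (fun x _ => esym (E x)) _; apply: deg_ltD => //.
by case: (boolP (p j)) => [/H//|_]; apply: deg_lt0.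
Qed.

Lemma deg_lt_mono f A : deg_lt #|f|.+1 (mono_ev f) A.
Proof.
rewrite cardE; have : forall x, \prod_(i <- enum f) x i = mono_ev f x.
  by move=> x; rewrite ffunE big_enum.
move=> E; apply: deg_lt_ext (fun x _ => E x) _.
elim: (enum f) => [|i s IH]; first by apply: deg_lt_ext (deg_lt_const 0 1 (A:=A)) => x; rewrite big_nil.
pose d : form m := ([ffun j => (j == i)%:R], 0).
apply: deg_lt_ext (deg_lt_mulform d IH) => x _; rewrite big_cons; congr (_ * _).
rewrite aevE (bigD1 i) //= ffunE eqxx mul1r addr0 big1 ?addr0 // => j /negbTE ji.
by rewrite ffunE ji mul0r.
Qed.

Lemma deg_lt_code I P A : in_code I P -> deg_lt (maxdeg I).+1 P A.
Proof.
case=> c cE; apply: deg_lt_ext (fun x _ => esym (cE x)) _; apply: deg_lt_sum => f fI.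
by apply: deg_lt_scale; apply: (deg_ltW _ (@deg_lt_mono f A)); rewrite ltnS; apply: leq_bigmax_cond.
Qed.

End Monomials.


(** * Orbits described by forms with prescribed leads *)

Section Orbits.
Variable m : nat.
Implicit Types (f g h : mono m) (row : 'I_m -> form m).

(** A form with lead [i.+1] is [x i] plus smaller variables and a constant, which is the shape of
    row [i] of a map in LTA. *)
Lemma lta_app_row (b : 'I_m -> 'I_m -> 'F_2) (e : 'I_m -> 'F_2) (a : form m) (i : 'I_m) x :
  lead a = i.+1 -> (forall j : 'I_m, (j < i)%N -> b i j = a.1 j) -> e i = a.2 ->
  lta_app b e x i = aev a x.
Proof.
move=> la ba ea; rewrite ffunE aevE ea [in RHS](bigD1 i) //= (lead_coef la) mul1r.
congr (_ + _ + _); rewrite big_mkcond [RHS]big_mkcond; apply: eq_bigr => j _.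
case: (ltngtP j i) => [ji|ij|/val_inj->] /=; last by rewrite eqxx.
  by rewrite ba // -val_eqE neq_ltn ji.
by rewrite -val_eqE neq_ltn ij orbT (lead_coef0 la) ?mul0r.
Qed.

(** Rows outside [f] are taken trivial, so the subgroup condition only concerns the smaller
    variables in the rows at [f]. *)
Lemma lta_orbit_row f g row : f \subset g ->
  (forall i, i \in f -> lead (row i) = i.+1) ->
  (forall i j : 'I_m, i \in f -> j \in g -> (j < i)%N -> (row i).1 j = 0) ->
  lta_orbit g f [ffun x => \prod_(i in f) aev (row i) x].
Proof.
move=> /subsetP fg lr r0.
exists (fun i j => if i \in f then (row i).1 j else 0), (fun i => if i \in f then (row i).2 else 0).
split; first split.
- by move=> i ig; case: ifP => // /fg; rewrite (negbTE ig).
- move=> i j ji; case: ifP => // iF; rewrite fg //= => jg; exact: r0.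
apply/ffunP=> x; rewrite !ffunE; apply: eq_bigr => i iF.
by rewrite (@lta_app_row _ _ (row i)) ?iF ?lr // => j _; rewrite iF.
Qed.

(** The rows define a bijection in LTA carrying [A] onto the flat where all coordinates in [h] are
    1. *)
Lemma card_flat_rows (A : {set pt m}) h row : (forall i, lead (row i) = i.+1) ->
  (forall x, (x \in A) = [forall i in h, aev (row i) x == 1]) -> (#|A| * 2 ^ #|h| = 2 ^ m)%N.
Proof.
move=> lr AE; pose T := lta_app (fun i j => (row i).1 j) (fun i => (row i).2).
(* The default value 1 of [pffun_on] is what fixes the coordinates in [h]; those outside [h] are
   free. *)
have -> : A = T @^-1: [set y in pffun_on 1 (~: h) predT].
  apply/setP=> x; rewrite AE inE in_set; apply/forall_inP/pffun_onP => [H|[/subsetP sT _] i ih].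
    split=> //; apply/subsetP=> i; rewrite !inE; apply: contra => ih.
    by rewrite (@lta_app_row _ _ (row i)) // H.
  apply: contraLR ih => ne; have := sT i; rewrite !inE; apply.
  by rewrite (@lta_app_row _ _ (row i)).
rewrite card_preimset; last exact: lta_app_inj.
rewrite cardsE card_pffun_on [#|_ : {pred 'F_2}|](card_ord 2) -expnD; congr (2 ^ _)%N.
by rewrite addnC cardsC card_ord.
Qed.

End Orbits.

(** * Assembling the factorisation of [P] *)

Unset Implicit Arguments.

Theorem theorem4 (m : nat) (I : {set mono m}) (P : Rm m) :
  decreasing I ->
  in_code I P ->
  (2 * wt P = 3 * 2 ^ (m - maxdeg I))%N ->
  exists f g : mono m,
    [/\ f \in I, g \in I, #|f| = maxdeg I, #|g| = maxdeg I &
    (#|f :&: g| + 2)%N = maxdeg I /\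
    exists A B C : Rm m,
      [/\ lta_orbit (f :&: g) (f :&: g) A,
          lta_orbit f (f :\: (f :&: g)) B,
          lta_orbit g (g :\: (f :&: g)) C &
          P = Rm_mul A (Rm_add B C)]].
Proof.
move=> dI cP W; set r := maxdeg I in W *.
have rm : (r <= m)%N.
  by apply/bigmax_leqP=> f _; rewrite -[X in (_ <= X)%N]card_ord; apply: max_card.
have W' : (2 * (2 ^ r * #|supp P [set: pt m]|) = 3 * 2 ^ m)%N.
  rewrite mulnCA (_ : #|supp P _| = wt P); last by apply: eq_card => x; rewrite !inE.
  by rewrite W mulnCA -expnD subnKC.
have [r2 [A [u1 [u2 [u3 [u4 [fA cA wA PA PE]]]]]]] := weight_three_halves (@deg_lt_code _ _ _ [set: pt m] cP) W'.
have A0 : A != set0.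
  by rewrite -card_gt0 lt0n; apply/eqP=> A0; move: cA; rewrite A0 muln0 => /esym/eqP;
    rewrite muln_eq0 expn_eq0.
set h := pivots A.
have [e eP] : exists e : 'I_m -> form m, forall i, i \in h ->
    [/\ vanish (e i) A, lead (e i) = i.+1 & forall j, j \in h -> j != i -> (e i).1 j = 0].
  apply: (fin_all_exists (P := fun i (a : form m) => i \in h ->
    [/\ vanish a A, lead a = i.+1 & forall j, j \in h -> j != i -> a.1 j = 0])) => i.
  by case: (boolP (i \in h)) => [/reduced_pivot[a aP]|_]; [exists a | exists 0].
have AE := @flat_pivots _ _ e fA A0 (fun i ih => let: And3 v l _ := eP i ih in conj v l).
(* Adding equations of [A] clears the pivot variables without changing values on [A]. *)
have red (u : form m) : exists v : form m, avoids h v /\ forall x, x \in A -> aev v x = aev u x.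
  have [b [/vanishP bA _ bh]] := reduce_pivots A m u; exists (u + b); split.
    by apply/avoidsP=> j jh; apply: bh.
  by move=> x xA; rewrite aevD bA ?addr0.
rewrite -/h in AE; clearbody h.
have [v1 [a1 E1]] := red u1; have [v2 [a2 E2]] := red u2.
have [v3 [a3 E3]] := red u3; have [v4 [a4 E4]] := red u4.
have R : represents P A h v1 v2 v3 v4.
  rewrite /represents a1 a2 a3 a4 /=; apply/forall_inP=> x xA.
  by rewrite PE // E1 ?E2 ?E3 ?E4.
have [w1 [w2 [w3 [w4 [s1 [s2 [s3 [s4 [{}R l1 l2 [l3 l4 us]]]]]]]]]] := distinct_leads fA A0 wA R.
move: us; rewrite /= !inE !negb_or => /and4P[/and3P[n12 n13 n14] /andP[n23 n24] n34 _].
have RE := representsP R; case/and5P: R => b1 b2 b3 b4 _.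
(* Each form of a pair is freed of the leading variable of the other, as the subgroups at [f] and
   [g] require. *)
have [z1 [z2 [/andP[c1 c2] k1 k2 [z12 z21] Z12]]] := reduce_pair n12 b1 b2 l1 l2.
have [z3 [z4 [/andP[c3 c4] k3 k4 [z34 z43] Z34]]] := reduce_pair n34 b3 b4 l3 l4.
have notin (z : form m) (s : 'I_m) : avoids h z -> lead z = s.+1 -> s \notin h.
  by move=> /avoidsP zh ls; apply/negP=> /zh; rewrite (lead_coef ls) => /eqP.
have [h1 h2 h3 h4] := And4 (notin _ _ c1 k1) (notin _ _ c2 k2) (notin _ _ c3 k3) (notin _ _ c4 k4).
(* These are the rows of one map in LTA. On [h] the constant 1 is added because the product over [h]
   must be 1 on [A], where the [e i] vanish. *)
pose row i : form m := if i \in h then e i + (0, 1) else if i == s1 then z1 else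
  if i == s2 then z2 else if i == s3 then z3 else if i == s4 then z4 else
  ([ffun j => (j == i)%:R], 0).
have rowh i : i \in h -> row i = e i + (0, 1) by rewrite /row => ->.
have row1 : row s1 = z1 by rewrite /row (negbTE h1) eqxx.
have row2 : row s2 = z2 by rewrite /row (negbTE h2) eq_sym (negbTE n12) eqxx.
have row3 : row s3 = z3.
  by rewrite /row (negbTE h3) ![s3 == _]eq_sym (negbTE n13) (negbTE n23) eqxx.
have row4 : row s4 = z4.
  by rewrite /row (negbTE h4) ![s4 == _]eq_sym (negbTE n14) (negbTE n24) (negbTE n34) eqxx.
have lrow i : lead (row i) = i.+1.
  rewrite /row; case: ifP => [ih|_]; first by rewrite lead_const; case: (eP i ih).
  case: eqP => [->//|_]; case: eqP => [->//|_]; case: eqP => [->//|_]; case: eqP => [->//|_].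
  apply/eqP; rewrite eqn_leq; apply/andP; split.
    by apply/lead_leP=> j ij; rewrite ffunE -val_eqE gtn_eqF.
  rewrite ltnNge; apply/lead_leP=> /(_ i (leqnn _)); rewrite ffunE eqxx => /eqP //.
have AE' x : (x \in A) = [forall i in h, aev (row i) x == 1].
  rewrite AE; apply: eq_forallb_in => i ih; rewrite rowh // aevD aev_const.
  by case: (F2P (aev (e i) x)) => ->.
(* [A] has codimension [r - 2] by [cA], and [#|h|] by its rows. *)
have ch : (#|h| + 2 = r)%N.
  have := card_flat_rows lrow AE' => cAh; move: cA; rewrite -cAh mulnCA (mulnC _ #|A|) => /eqP.
  rewrite eqn_pmul2l ?card_gt0 // (_ : 4 = 2 ^ 2)%N // -expnD eqn_exp2l // => /eqP rE.
  by rewrite addnC -rE.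
pose f := h :|: [set s1; s2]; pose g := h :|: [set s3; s4].
have fgh : f :&: g = h.
  apply/setP=> i; rewrite !inE; case: (i \in h) => //=.
  case: eqP => [->|_]; first by rewrite (negbTE n13) (negbTE n14).
  by case: eqP => [->|_] //=; rewrite (negbTE n23) (negbTE n24).
have pairD s s' : s \notin h -> s' \notin h -> (h :|: [set s; s']) :\: h = [set s; s'].
  move=> sh s'h; apply/setP=> i; rewrite !inE; case: (boolP (i \in h)) => //= ih.
  by apply/esym/negbTE; rewrite negb_or; apply/andP; split; apply: contraTneq ih => ->.
have cardU s s' : s \notin h -> s' \notin h -> s != s' -> #|h :|: [set s; s']| = r.
  by move=> sh s'h ss'; rewrite -ch -(cardsID h) setUK pairD // cards2 ss'.
have prod2 s s' x : s != s' -> \prod_(i in [set s; s']) aev (row i) x = aev (row s) x * aev (row s') x.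
  by move=> ss'; rewrite big_setU1 ?inE //= big_set1.
pose PA' : Rm m := [ffun x => \prod_(i in h) aev (row i) x].
pose PB : Rm m := [ffun x => \prod_(i in [set s1; s2]) aev (row i) x].
pose PC : Rm m := [ffun x => \prod_(i in [set s3; s4]) aev (row i) x].
have PEq : P = Rm_mul PA' (Rm_add PB PC).
  apply/ffunP=> x; rewrite !ffunE !prod2 // row1 row2 row3 row4.
  case: (boolP (x \in A)) => xA.
    rewrite big1; last by move=> i ih; move: xA; rewrite AE' => /forall_inP/(_ i ih)/eqP.
    by rewrite mul1r Z12 Z34 RE.
  rewrite PA //; move: xA; rewrite AE' negb_forall_in => /exists_inP[i ih].
  by rewrite -F2_neq0 negbK => /eqP ri; rewrite (bigD1 i) //= ri !mul0r.
(* The map with these rows sends [f + g] to [P], so invertibility of the action on the code brings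
   [f + g] into it. *)
have [fI gI] : f \in I /\ g \in I.
  pose b i j := (row i).1 j; pose t i := (row i).2.
  apply: in_code_add_mono.
    by apply/eqP=> /setP/(_ s1); rewrite !inE eqxx orbT (negbTE h1) (negbTE n13) (negbTE n14).
  apply: (in_code_lta_inv (b := b) (e := t)) dI _; congr (in_code I _): cP.
  rewrite PEq; apply/ffunP=> x; rewrite !ffunE.
  have monoU s s' : s \notin h -> s' \notin h ->
      \prod_(i in h :|: [set s; s']) lta_app b t x i =
      \prod_(i in h) aev (row i) x * \prod_(i in [set s; s']) aev (row i) x.
    move=> sh s'h; rewrite -big_setU /=; last exact: F2_mulxx.
    by apply: eq_bigr => i _; apply: lta_app_row.
  by rewrite !monoU // mulrDr.
exists f, g; rewrite fgh; split=> //; [exact: cardU | exact: cardU | split=> //].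
have lowerh i j : i \in h -> j \in h -> (j < i)%N -> (row i).1 j = 0.
  move=> ih jh ji; rewrite rowh // !ffunE addr0; case: (eP i ih) => _ _; apply=> //.
  by rewrite -val_eqE neq_ltn ji.
have lowerp (y y' : form m) (s s' : 'I_m) : row s = y -> row s' = y' -> avoids h y -> avoids h y' ->
    y.1 s' = 0 -> y'.1 s = 0 ->
    forall i j : 'I_m, i \in [set s; s'] -> j \in h :|: [set s; s'] -> (j < i)%N -> (row i).1 j = 0.
  move=> rs rs' /avoidsP yh /avoidsP y'h ys' y's i j; rewrite !inE.
  case/orP=> /eqP-> /or3P[jh|/eqP->|/eqP->]; rewrite ?ltnn ?rs ?rs' // => _.
    exact: yh.
  exact: y'h.
exists PA', PB, PC; split=> //.
- exact: lta_orbit_row.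
- rewrite pairD //; apply: lta_orbit_row => //; [exact: subsetUr | exact: (lowerp z1 z2)].
- rewrite pairD //; apply: lta_orbit_row => //; [exact: subsetUr | exact: (lowerp z3 z4)].
Qed.
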